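(* For $p\in[\omega(\log^4 n\log\log n/n),\,1/2]$ and $d=o\!\left((pn/\log n)^{3/4}/\log^{1/4}(pn)\right)$, with probability at least $1-\exp(-\omega(\log n))$ every pair of distinct vertices of $G(n,p)$ has $(pn,4d+1)$-disjoint degree neighborhoods.
   Context: $G(n,p)$ is the Erdős–Rényi random graph on $n$ vertices with independent edge probability $p$; asymptotics are as $n\to\infty$. For a vertex $u$ of a graph $G$, let $D_u$ be the multiset of the degrees (in $G$) of the neighbors of $u$ whose degrees are at most $m$. Two distinct vertices $u,v$ have $(m,k)$-disjoint degree neighborhoods if $|D_u\oplus D_v|\ge k$, where for multisets the symmetric difference size is $\sum_x|\mathrm{mult}_{D_u}(x)-\mathrm{mult}_{D_v}(x)|$. *)

(* Defs.v *)
From HB Require Import structures.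
From mathcomp Require Import all_boot all_order all_algebra finmap multiset.
From mathcomp Require Import all_classical all_reals all_analysis.

Set Implicit Arguments.
Unset Strict Implicit.
Unset Printing Implicit Defensive.

Import Order.TTheory GRing.Theory Num.Theory.
Import numFieldNormedType.Exports.

Local Open Scope ring_scope.

Definition vpair (n : nat) := {e : {set 'I_n} | #|e| == 2}.

(* Every set of unordered pairs is a simple graph on 'I_n, so the finite type
   [graph n] ranges over all labelled graphs exactly once. *)
Definition graph (n : nat) := {set vpair n}.

(* Irreflexive, because [set u; u] is not of cardinality 2. *)
Definition adj (n : nat) (G : graph n) (u v : 'I_n) : bool :=
  [exists e in G, val e == [set u; v]].

Definition nbrs (n : nat) (G : graph n) (u : 'I_n) : {set 'I_n} :=
  [set v | adj G u v].

Definition deg (n : nat) (G : graph n) (u : 'I_n) : nat := #|nbrs G u|.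

(* Degrees are taken in G itself, not in the subgraph of low-degree vertices. *)
Definition deg_nbhd (R : realType) (n : nat) (G : graph n) (m : R) (u : 'I_n) :
    multiset nat :=
  seq_mset [seq deg G v | v <- enum (nbrs G u) & (deg G v)%:R <= m].

(* |A (+) B|; multiplicities vanish outside the union of the supports.  The
   minus sign under `|_|%N is subtraction of integers, not of naturals. *)
Definition msymdiff_size (A B : multiset nat) : nat :=
  (\sum_(x <- (finsupp A `|` finsupp B)%fset) `|(A x)%:Z - (B x)%:Z|)%N.

Definition disjoint_deg_nbhds (R : realType) (n : nat) (G : graph n)
    (m k : R) (u v : 'I_n) : bool :=
  k <= (msymdiff_size (deg_nbhd G m u) (deg_nbhd G m v))%:R.

(* Probability that G(n,p) satisfies A: the edge indicators are independent
   Bernoulli(p), so a given G has probability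
   p^(number of edges) * (1-p)^(number of non-edges). *)
Definition Pr_Gnp (R : realType) (n : nat) (p : R) (A : pred (graph n)) : R :=
  \sum_(G : graph n | A G) \prod_(e : vpair n) (if e \in G then p else 1 - p).

Lemma Pr_Gnp_total (R : realType) (n : nat) (p : R) :
  Pr_Gnp p (predT : pred (graph n)) = 1.
Proof.
transitivity (\prod_(e : vpair n) (p + (1 - p))); last first.
  by rewrite big1 // => e _; rewrite addrC subrK.
rewrite bigA_distr; apply: eq_bigr => G _.
by [].
Qed.

(* f = omega(g) as n tends to infinity, for an eventually positive g. *)
Definition little_omega (R : realType) (f g : nat -> R) : Prop :=
  (f n / g n @[n --> \oo] --> +oo)%classic.

(* Main.v *)
Require Import Defs.
From HB Require Import structures.
From mathcomp Require Import all_boot all_order all_algebra finmap multiset.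
From mathcomp Require Import all_classical all_reals all_analysis.
From mathcomp Require Import ring lra zify.

Set Implicit Arguments.
Unset Strict Implicit.
Unset Printing Implicit Defensive.

Import Order.TTheory GRing.Theory Num.Theory.
Import numFieldNormedType.Exports.

Local Open Scope ring_scope.

(** Fix two vertices u and v, let s^4 = p n be the mean degree, A the set of
neighbours of u that are not adjacent to v, and W the set of vertices adjacent
to neither.  Condition on every edge not joining A to W.  The degrees in G of
the vertices of A are then independent shifted binomials, while the degrees of
all the other neighbours of u and v are frozen, so the size of the symmetric
difference is at least f = \sum_x |X_x - b_x|, where X_x counts the a in A of
degree x, the b_x are constants, and x runs over a window of length ~ s^2 just
below p n.  A binomial takes each value of that window with probability of
order s^-2, so X_x, a sum of about s^4 independent indicators, has standard
deviation of order s; its characteristic function at 1/s is bounded away from 1,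
hence E|X_x - b_x| is of order s for every b_x, and E f is of order s^3.
Changing the edges at one vertex of A changes f by at most 2, so the method of
bounded differences gives f >= c s^3 outside an event of probability
exp(- c' s^2).  Since s^2 >= (ln n)^2, a union bound over the pairs concludes. *)

(** * Real inequalities *)

Section RealInequalities.
Variable R : realType.
Implicit Types x y t h : R.

(** Squaring [1 - y / 2 <= expR (- y / 2)] bounds [expR y] by the inverse square of [1 - y / 2].
    What remains is polynomial, and [y <= 1 / 3] enters as [0 <= 1 - 3 * y]. *)
Lemma expR_le_quadratic y : `|y| <= 1 / 3 -> expR y <= 1 + y + y ^+ 2.
Proof.
rewrite ler_norml => /andP[yl yr].
have h0 : 0 < 1 - y / 2 by lra.
have h1 : expR (y / 2) <= (1 - y / 2)^-1.
  rewrite -[y / 2 in leLHS]opprK expRN lef_pV2 ?posrE ?expR_gt0 //.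
  exact: expR_ge1Dx.
have -> : expR y = expR (y / 2) ^+ 2.
  by rewrite -expRM_natr; congr expR; field.
apply: (@le_trans _ _ ((1 - y / 2)^-1 ^+ 2)).
  by apply: lerXn2r; rewrite ?nnegrE ?expR_ge0 ?invr_ge0 ?(ltW h0).
rewrite exprVn -[leLHS]mul1r ler_pdivrMr ?exprn_gt0 //.
have -> : (1 + y + y ^+ 2) * (1 - y / 2) ^+ 2 =
  1 + y ^+ 2 * (1 - 3 * y + y ^+ 2) / 4 by field.
rewrite lerDl divr_ge0 // mulr_ge0 ?sqr_ge0 //.
by have := sqr_ge0 y; lra.
Qed.

Lemma expR_le_oneB h : 0 <= h <= 1 / 2 -> expR (- (2 * h)) <= 1 - h.
Proof.
move=> /andP[h0 h1]; rewrite expRN -[leLHS]mul1r ler_pdivrMr ?expR_gt0 //.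
apply: (@le_trans _ _ ((1 - h) * (1 + 2 * h))); first by nra.
by rewrite ler_wpM2l ?expR_ge1Dx //; lra.
Qed.

Lemma sin_eq_mul_cos x : 0 < x -> exists2 c, 0 < c < x & sin x = cos c * x.
Proof.
move=> x0.
have [c] := @MVT R sin cos 0 x x0 (fun y _ => is_derive_sin y)
  (continuous_subspaceT (@continuous_sin R)).
by rewrite in_itv /= sin0 !subr0 => ? ->; exists c.
Qed.

Lemma abs_sin_le x : `|sin x| <= `|x|.
Proof.
have pos y : 0 < y -> `|sin y| <= `|y|.
  move=> /sin_eq_mul_cos[c _ ->]; rewrite normrM.
  by rewrite ler_piMl // cos_max.
case: (ltgtP x 0) => [x0|x0|->]; [|exact: pos|by rewrite sin0].
by rewrite -normrN -sinN -[in leRHS]normrN; apply: pos; rewrite oppr_gt0.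
Qed.

Lemma one_sub_cosE x : 1 - cos x = 2 * sin (x / 2) ^+ 2.
Proof.
have -> : cos x = cos ((x / 2) *+ 2) by congr cos; rewrite -mulr_natr; field.
by rewrite cos_mulr2n cos2sin2 -mulr_natr; ring.
Qed.

Lemma one_sub_cos_le x : 1 - cos x <= `|x|.
Proof.
have := abs_sin_le (x / 2); have := sin_max (x / 2).
have := normr_ge0 (sin (x / 2)).
rewrite one_sub_cosE -real_normK ?num_real // normrM.
have -> : `|2^-1 : R| = 2^-1 by rewrite ger0_norm ?invr_ge0.
by nra.
Qed.

(** The mean value point lies below 1/2, where the cosine is at least 1/2; hence [sin (t / 2)] is at
    least [t / 4]. *)
Lemma one_sub_cos_ge t : 0 <= t <= 1 -> t ^+ 2 / 8 <= 1 - cos t.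
Proof.
move=> /andP[]; rewrite le_eqVlt => /orP[/eqP<-|t0 t1].
  by rewrite cos0 expr0n /= mul0r subrr.
have [c /andP[c0 ct] sE] : exists2 c, 0 < c < t / 2 & sin (t / 2) = cos c * (t / 2).
  by apply: sin_eq_mul_cos; lra.
have hc : 1 / 2 <= cos c by have := one_sub_cos_le c; rewrite gtr0_norm //; lra.
rewrite one_sub_cosE sE.
have : t / 4 <= cos c * (t / 2) by nra.
by nra.
Qed.

End RealInequalities.

(** * Random subsets and resampling *)

Section RandomSubset.
Variables (R : realType) (E : finType) (p : R).
Hypothesis p01 : 0 <= p <= 1.
Implicit Types (G S F : {set E}) (f g : {set E} -> R) (P Q : pred {set E}).

(** The law of a random subset of [E] that contains each element independently with probability [p];
    for [E] the set of vertex pairs it is G(n, p). *)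
Definition weight G : R := \prod_e (if e \in G then p else 1 - p).

Definition Ex f : R := \sum_G weight G * f G.

Definition Pr P : R := Ex (fun G => (P G)%:R).

Lemma p_ge0 : 0 <= p. Proof. by case/andP: p01. Qed.
Lemma onem_p_ge0 : 0 <= 1 - p. Proof. by case/andP: p01 => _; lra. Qed.

Lemma weight_ge0 G : 0 <= weight G.
Proof. by apply: prodr_ge0 => e _; case: ifP; rewrite ?p_ge0 ?onem_p_ge0. Qed.

(** Independence in generating-function form: expanding the product on the right selects, for each
    [e], whether it belongs to [G]. *)
Lemma Ex_prod (z : E -> R) :
  Ex (fun G => \prod_(e in G) z e) = \prod_e (1 - p + p * z e).
Proof.
under [RHS]eq_bigr do rewrite addrC.
rewrite bigA_distr; apply: eq_bigr => G _.
rewrite /weight [X in _ * X]big_mkcond -big_split /=.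
by apply: eq_bigr => e _; case: ifP; rewrite ?mulr1.
Qed.

Lemma eq_Ex f g : f =1 g -> Ex f = Ex g.
Proof. by move=> fg; apply: eq_bigr => G _; rewrite fg. Qed.

Lemma sum_weight : \sum_G weight G = 1.
Proof.
have := Ex_prod (fun=> 1); under eq_Ex do rewrite big1 //.
under [RHS]eq_bigr do rewrite mulr1 subrK.
by rewrite big1 // /Ex -mulr_suml mulr1.
Qed.

Lemma Ex_cst c : Ex (fun=> c) = c.
Proof. by rewrite /Ex -mulr_suml sum_weight mul1r. Qed.

Lemma ExD f g : Ex (fun G => f G + g G) = Ex f + Ex g.
Proof. by rewrite -big_split; apply: eq_bigr => G _; rewrite mulrDr. Qed.

Lemma ExZ c f : Ex (fun G => c * f G) = c * Ex f.
Proof. by rewrite [RHS]mulr_sumr; apply: eq_bigr => G _; rewrite mulrCA. Qed.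

Lemma ExZr c f : Ex (fun G => f G * c) = Ex f * c.
Proof. by under eq_Ex do rewrite mulrC; rewrite ExZ mulrC. Qed.

Lemma ExN f : Ex (fun G => - f G) = - Ex f.
Proof. by under eq_Ex do rewrite -mulN1r; rewrite ExZ mulN1r. Qed.

Lemma ExB f g : Ex (fun G => f G - g G) = Ex f - Ex g.
Proof. by rewrite ExD ExN. Qed.

Lemma Ex_sum (I : Type) (r : seq I) (A : pred I) (f : I -> {set E} -> R) :
  Ex (fun G => \sum_(i <- r | A i) f i G) = \sum_(i <- r | A i) Ex (f i).
Proof. by rewrite [RHS]exchange_big; apply: eq_bigr => G _; rewrite mulr_sumr. Qed.

Lemma le_Ex f g : (forall G, f G <= g G) -> Ex f <= Ex g.
Proof. by move=> fg; apply: ler_sum => G _; rewrite ler_wpM2l ?weight_ge0. Qed.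

Lemma Ex_ge0 f : (forall G, 0 <= f G) -> 0 <= Ex f.
Proof. by move=> f0; rewrite -(Ex_cst 0); apply: le_Ex. Qed.

Lemma abs_Ex_le f : `|Ex f| <= Ex (fun G => `|f G|).
Proof.
apply: le_trans (ler_norm_sum _ _ _) _; apply: ler_sum => G _.
by rewrite normrM (ger0_norm (weight_ge0 G)).
Qed.

Lemma Pr_ge0 P : 0 <= Pr P.
Proof. by apply: Ex_ge0 => G; rewrite ler0n. Qed.

Lemma le_Pr P Q : (forall G, P G -> Q G) -> Pr P <= Pr Q.
Proof.
by move=> PQ; apply: le_Ex => G; rewrite ler_nat; case: (P G) (PQ G) => // ->.
Qed.

Lemma Pr_le1 P : Pr P <= 1.
Proof. by rewrite -[leRHS]Ex_cst; apply: le_Ex => G; rewrite lern1 leq_b1. Qed.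

Lemma PrC P : Pr (fun G => ~~ P G) = 1 - Pr P.
Proof.
rewrite -[X in X - _]Ex_cst -ExB; apply: eq_Ex => G.
by case: (P G); rewrite ?subr0 ?subrr.
Qed.

Lemma PrU_le P Q : Pr (fun G => P G || Q G) <= Pr P + Pr Q.
Proof.
rewrite -ExD; apply: le_Ex => G; rewrite -natrD ler_nat.
by case: (P G); case: (Q G).
Qed.

Lemma Pr_exists_le (I : finType) (A : pred I) (P : I -> pred {set E}) :
  Pr (fun G => [exists i, A i && P i G]) <= \sum_(i | A i) Pr (P i).
Proof.
rewrite -Ex_sum; apply: le_Ex => G.
case: existsP => [[i /andP[Ai Pi]]|_]; last by apply: sumr_ge0 => i _; rewrite ler0n.
rewrite (bigD1 i) //= Pi lerDl; apply: sumr_ge0 => j _; exact: ler0n.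
Qed.

Lemma markov P f : (forall G, 0 <= f G) -> (forall G, P G -> 1 <= f G) ->
  Pr P <= Ex f.
Proof.
by move=> f0 f1; apply: le_Ex => G; case: (boolP (P G)) => [/f1|] //=.
Qed.

(** Redraws from [S] the part of [G] inside [F]. Averaging over [S] thus conditions on the part of
    [G] outside [F]. *)
Definition mix F G S : {set E} := (G :\: F) :|: (S :&: F).

Lemma in_mix F G S e : (e \in mix F G S) = if e \in F then e \in S else e \in G.
Proof. by rewrite !inE; case: (e \in F); rewrite ?andbT ?andbF ?orbF. Qed.

(* Exchanging the parts of G and S inside F G is a weight-preserving
   involution of the pairs (G, S). *)
Lemma Ex_resample (F : {set E} -> {set E}) f :
  (forall G S, F (mix (F G) G S) = F G) ->
  Ex f = Ex (fun G => Ex (fun S => f (mix (F G) G S))).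
Proof.
move=> Finv.
have -> : Ex f = \sum_G \sum_S weight G * weight S * f G.
  apply: eq_bigr => G _; rewrite -mulr_suml -mulr_sumr; congr (_ * _).
  by rewrite sum_weight mulr1.
have -> : Ex (fun G => Ex (fun S => f (mix (F G) G S))) =
    \sum_G \sum_S weight G * weight S * f (mix (F G) G S).
  by apply: eq_bigr => G _; rewrite mulr_sumr; apply: eq_bigr => S _; rewrite mulrA.
rewrite !pair_bigA /=.
pose h (x : {set E} * {set E}) := (mix (F x.1) x.1 x.2, mix (F x.1) x.2 x.1).
have hK : involutive h.
  move=> [G S]; rewrite /h /= Finv; congr pair; apply/setP => e;
    by rewrite !in_mix; case: (e \in F G).
rewrite (reindex_inj (inv_inj hK)) /=; apply: eq_bigr => -[G S] _ /=.
congr (_ * _); rewrite /weight -!big_split; apply: eq_bigr => e _ /=.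
by rewrite !in_mix; case: (e \in F G) => //; rewrite mulrC.
Qed.

Lemma Ex_mix F f : Ex f = Ex (fun G => Ex (fun S => f (mix F G S))).
Proof. exact: (@Ex_resample (fun=> F)). Qed.

(** The redrawn set may depend on [G], as long as it is determined, like [P], by the part of [G]
    that is kept. A bound on [Q] that holds conditionally whenever [P] does then averages to the
    same bound. *)
Lemma Pr_cond_le (F : {set E} -> {set E}) P Q (c : R) : 0 <= c ->
  (forall G S, F (mix (F G) G S) = F G) ->
  (forall G S, P (mix (F G) G S) = P G) ->
  (forall G, P G -> Pr (fun S => Q (mix (F G) G S)) <= c) ->
  Pr (fun G => P G && Q G) <= c.
Proof.
move=> c0 Finv Pinv PQ; rewrite /Pr (Ex_resample _ Finv) -[leRHS]Ex_cst.
apply: le_Ex => G; under eq_Ex do rewrite Pinv.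
by case: (boolP (P G)) => [/PQ//|_]; rewrite Ex_cst.
Qed.

(** The hypotheses say that [f] sees only [F] and [g] only the complement. *)
Lemma Ex_indep F f g : (forall G S, f (mix F G S) = f S) ->
  (forall G S, g (mix F G S) = g G) -> Ex (fun G => f G * g G) = Ex f * Ex g.
Proof.
move=> hf hg; rewrite (Ex_mix F); under eq_Ex do under eq_Ex do rewrite hf hg.
by under eq_Ex do rewrite ExZr; rewrite ExZ.
Qed.

End RandomSubset.

(** * Exponential tails and the binomial distribution *)

Section Concentration.
Variables (R : realType) (E : finType) (p : R).
Hypothesis p01 : 0 <= p <= 1.
Implicit Types (G S F : {set E}) (f g : {set E} -> R) (P Q : pred {set E}).
Local Notation Ex := (Ex p).
Local Notation Pr := (Pr p).

Let p0 : 0 <= p := p_ge0 p01.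
Let q0 : 0 <= 1 - p := onem_p_ge0 p01.

(** Each factor [1 - p + p * expR (l * c e)] is at most the exponential of
    [p * (l * c e + (l * c e) ^+ 2)], and the centring cancels the linear terms. *)
Lemma mgf_le (c : E -> R) (l : R) : (forall e, `|l * c e| <= 1 / 3) ->
  Ex (fun G => expR (l * (\sum_(e in G) c e - p * \sum_e c e))) <=
    expR (p * l ^+ 2 * \sum_e c e ^+ 2).
Proof.
move=> lc.
under eq_Ex => G do rewrite mulrBr expRB mulr_sumr expR_sum.
rewrite ExZr Ex_prod -expRN -[X in _ <= X]mul1r.
rewrite -[X in _ <= X * _](expRxMexpNx_1 (l * (p * \sum_e c e))) mulrAC.
rewrite ler_wpM2r ?expR_ge0 //.
rewrite -expRD !mulr_sumr -big_split expR_sum /=.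
apply: ler_prod => e _; rewrite addr_ge0 ?mulr_ge0 ?expR_ge0 //=.
apply: le_trans (expR_ge1Dx _).
by have := ler_wpM2l p0 (expR_le_quadratic (lc e)); rewrite exprMn; lra.
Qed.

Lemma weighted_tail (c : E -> R) (l D : R) : 0 <= l ->
  (forall e, `|l * c e| <= 1 / 3) ->
  Pr (fun G => D <= `|\sum_(e in G) c e - p * \sum_e c e|) <=
    2 * expR (p * l ^+ 2 * \sum_e c e ^+ 2 - l * D).
Proof.
move=> l0 lc; set X := fun G => \sum_(e in G) c e - p * \sum_e c e.
(* Markov for the sum of both exponentials treats the two tails at once. *)
apply: (@le_trans _ _ (Ex (fun G =>
    (expR (l * X G) + expR (- l * X G)) * expR (- (l * D))))).
  apply: (markov p01) => G.
    by rewrite mulr_ge0 ?addr_ge0 ?expR_ge0.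
  rewrite -/(X G) mulrDl -!expRD => DX.
  have h (y : R) : 0 <= y -> 1 <= expR y by move=> ?; apply: le_trans (expR_ge1Dx _); rewrite lerDl.
  have := expR_ge0 (l * X G - l * D); have := expR_ge0 (- l * X G - l * D).
  move: DX; rewrite ler_normr => /orP[DX|DX].
    have := @h (l * X G - l * D); rewrite -mulrBr mulr_ge0 ?subr_ge0 // => /(_ isT).
    by lra.
  have := @h (- l * X G - l * D); rewrite mulNr -mulrN -mulrBr mulr_ge0 ?subr_ge0 // => /(_ isT).
  by lra.
rewrite ExZr ExD expRD mulrA ler_wpM2r ?expR_ge0 //.
have := mgf_le lc; rewrite -/X => h1.
have : Ex (fun G => expR (- l * X G)) <= expR (p * l ^+ 2 * \sum_e c e ^+ 2).
  rewrite -[l ^+ 2]sqrrN; apply: mgf_le => e.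
  by rewrite mulNr normrN.
by lra.
Qed.

Lemma card_setI_sum G F : #|G :&: F|%:R = \sum_(e in G) (e \in F)%:R :> R.
Proof.
rewrite -sum1_card natr_sum big_mkcond [RHS]big_mkcond /=.
by apply: eq_bigr => e _; rewrite inE; case: (e \in G); case: (e \in F).
Qed.

Lemma card_sum F : #|F|%:R = \sum_e (e \in F)%:R :> R.
Proof.
by rewrite -sum1_card natr_sum big_mkcond; apply: eq_bigr => e _; case: ifP.
Qed.

Lemma binomial_tail F (l D : R) : 0 <= l <= 1 / 3 ->
  Pr (fun G => D <= `|#|G :&: F|%:R - p * #|F|%:R|) <=
    2 * expR (p * l ^+ 2 * #|F|%:R - l * D).
Proof.
move=> /andP[l0 l1]; have := @weighted_tail (fun e => (e \in F)%:R) l D l0.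
have -> : \sum_e (e \in F)%:R ^+ 2 = #|F|%:R :> R.
  by rewrite card_sum; apply: eq_bigr => e _; case: (e \in F); rewrite ?expr1n ?expr0n.
rewrite -card_sum => h; apply: le_trans (h _).
  by apply: le_Pr => // G; rewrite card_setI_sum.
by move=> e; case: (e \in F); rewrite ?mulr1 ?mulr0 ?normr0 // ger0_norm.
Qed.

(** The binomial mass function, kept as a probability: the recurrence for consecutive values
    replaces binomial coefficients. *)
Definition binom_pmf F (y : nat) : R := Pr (fun S => #|S :&: F| == y).

Lemma weight_setU1 (e : E) S : e \notin S ->
  weight p (e |: S) * (1 - p) = weight p S * p.
Proof.
move=> eS; rewrite /weight !(bigD1 (P := predT) e) //= finset.setU11 (negbTE eS).
have -> : \prod_(i | i != e) (if i \in e |: S then p else 1 - p) =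
    \prod_(i | i != e) (if i \in S then p else 1 - p).
  by apply: eq_bigr => i ie; rewrite !inE (negbTE ie).
by ring.
Qed.

(* Double count the pairs (S, e) with e in F and not in S, adding e to S. *)
Lemma binom_pmf_rec F y : y.+1%:R * (1 - p) * binom_pmf F y.+1 =
  (#|F|%:R - y%:R) * p * binom_pmf F y.
Proof.
transitivity (\sum_(e in F) \sum_(S : {set E} | (e \in S) && (#|S :&: F| == y.+1))
    weight p S * (1 - p)).
  rewrite mulr_sumr.
  under [RHS]eq_bigr do rewrite big_mkcond.
  rewrite exchange_big; apply: eq_bigr => S _ /=.
  case: eqP => [cS|_]; last first.
    by rewrite !mulr0 big1 // => e _; rewrite andbF.
  under eq_bigr do rewrite andbT.
  rewrite -big_mkcondr sumr_const.
  have -> : #|[pred e | (e \in F) && (e \in S)]| = y.+1.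
    by rewrite -cS; apply: eq_card => e; rewrite !inE andbC.
  by rewrite -[RHS]mulr_natr mulr1 -natr1; ring.
transitivity (\sum_(e in F) \sum_(S : {set E} | (e \notin S) && (#|S :&: F| == y))
    weight p S * p); last first.
  rewrite [RHS]mulr_sumr.
  under [LHS]eq_bigr do rewrite big_mkcond.
  rewrite exchange_big; apply: eq_bigr => S _ /=.
  case: eqP => [cS|_]; last first.
    by rewrite !mulr0 big1 // => e _; rewrite andbF.
  under eq_bigr do rewrite andbT.
  rewrite -big_mkcondr sumr_const.
  have <- : (#|F| - y = #|[pred e | (e \in F) && (e \notin S)]|)%N.
    rewrite -cS -(cardsID S F) finset.setIC addKn.
    by apply: eq_card => e; rewrite !inE andbC.
  rewrite -[LHS]mulr_natr natrB ?mulr1; first by ring.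
  by rewrite -cS subset_leq_card // finset.subsetIr.
apply: eq_bigr => e eF.
rewrite (reindex_onto (fun S => e |: S) (fun S => S :\ e)); last first.
  by move=> S /andP[eS _]; rewrite finset.setD1K.
apply: eq_big => [S|S /andP[/andP[_ _] /eqP SE]].
  rewrite finset.setU11 /=; case: (boolP (e \in S)) => eS /=.
    apply/negbTE; rewrite negb_and orbC; apply/orP; left.
    by apply/eqP => h; move: eS; rewrite -h !inE eqxx.
  rewrite finset.setU1K // eqxx andbT finset.setIUl.
  have -> : [set e] :&: F = [set e] by apply/finset.setIidPl; rewrite finset.sub1set.
  by rewrite cardsU1 !inE (negbTE eS) add1n eqSS.
by rewrite weight_setU1 // -SE !inE eqxx.
Qed.

Lemma binom_pmf_ge0 F y : 0 <= binom_pmf F y.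
Proof. exact: Pr_ge0. Qed.

Lemma binom_pmf_sum F (A : pred nat) :
  \sum_(y < #|E|.+1 | A y) binom_pmf F y = Pr (fun S => A #|S :&: F|).
Proof.
rewrite -Ex_sum; apply: eq_Ex => S.
have lt : (#|S :&: F| < #|E|.+1)%N by rewrite ltnS max_card.
case: (boolP (A #|S :&: F|)) => AS.
  rewrite (bigD1 (Ordinal lt)) //= eqxx big1 ?addr0 // => i /andP[_ ne].
  case: eqP => // ie; case/eqP: ne; exact/val_inj.
by rewrite big1 // => i Ai; case: eqP => // ie; rewrite ie Ai in AS.
Qed.

Lemma binom_pmf_add_le1 F y : binom_pmf F y + binom_pmf F y.+1 <= 1.
Proof.
rewrite -ExD -[leRHS](Ex_cst E p); apply: le_Ex => // S.
by rewrite -natrD lern1; case: eqP => [->|_]; rewrite ?(ltn_eqF (ltnSn y)) ?leq_b1.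
Qed.

Lemma card_ord_interval n k l :
  (#|[pred i : 'I_n | (k <= i < k + l)%N]| <= l)%N.
Proof.
rewrite cardE -(size_map val) -[leqRHS](size_iota k); apply: uniq_leq_size.
  by rewrite map_inj_uniq ?enum_uniq //; exact: val_inj.
by move=> x /mapP[i]; rewrite mem_enum inE mem_iota => ? ->.
Qed.

End Concentration.

(** * Local lower bound for the binomial distribution *)

Section LocalLimit.
Variables (R : realType) (E : finType) (p : R).
Hypothesis p01 : 0 < p <= 1 / 2.
Variables (F : {set E}) (s : R).
Local Notation m := (#|F|%:R : R).
Local Notation b := (binom_pmf p F).
Hypothesis s_large : 50 * 50 <= s ^+ 2.
Hypothesis mean_bounds : s ^+ 4 / 16 <= p * m <= s ^+ 4.

Let p01' : 0 <= p <= 1.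
Proof. by case/andP: p01 => ? ?; apply/andP; split; lra. Qed.

(** As the mean is at most [s ^+ 4], the standard deviation is at most [s ^+ 2]. *)
Definition central (y : nat) := `|y%:R - p * m| <= 16 * s ^+ 2.

Let s_neq0 : s != 0.
Proof.
by apply/eqP => s0; have := s_large; rewrite s0 expr0n /=; lra.
Qed.

(** Bound on the relative change of the mass function in one central step; [s >= 50] brings it below
    1/2. *)
Let h : R := (17 * 64) / s ^+ 2.

Let h_bounds : 0 <= h <= 1 / 2.
Proof.
have s2 : 0 < s ^+ 2 by have := s_large; lra.
by have := s_large; rewrite /h ler_pdivrMr // divr_ge0 ?(ltW s2) /=; lra.
Qed.

(** The two coefficients of the recurrence differ by at most [17 * s ^+ 2] and are both at least
    [s ^+ 4 / 64], so their ratio is within [h] of 1. *)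
Lemma binom_pmf_ratio y : central y -> central y.+1 ->
  (1 - h) * b y <= b y.+1 /\ (1 - h) * b y.+1 <= b y.
Proof.
rewrite /central !ler_norml -natr1 => /andP[y1 y2] /andP[y3 y4].
have /andP[M1 M2] := mean_bounds; have /andP[pp ph] := p01.
have := binom_pmf_rec p F y; rewrite -natr1.
have := binom_pmf_ge0 p01' F y; have := binom_pmf_ge0 p01' F y.+1.
have s4 : s ^+ 4 = s ^+ 2 * s ^+ 2 by rewrite -exprD.
set Y := y%:R : R in y1 y2 y3 y4 *.
set B := b y; set B' := b y.+1 => B0 B0' rec.
have Y0 : 0 <= Y by apply: ler0n.
rewrite s4 in M1 M2; move: M1 M2 y1 y2 y3 y4 s_large; rewrite /h.
move: rec; set S := s ^+ 2; set M := m => rec M1 M2 y1 y2 y3 y4 S0.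
have Spos : 0 < S by lra.
set den := (Y + 1) * (1 - p); set num := (M - Y) * p.
have den_ge : S * S / 64 <= den by rewrite /den; nra.
have num_ge : S * S / 64 <= num.
  have : S * S / 8 <= M by nra.
  rewrite /num; nra.
have S2 : 0 < S * S by nra.
have diff : `|num - den| <= 17 * S.
  by rewrite ler_norml /num /den; apply/andP; split; nra.
have hd (d : R) : S * S / 64 <= d -> 17 * S <= d * ((17 * 64) / S).
  move=> dge; apply: (@le_trans _ _ (S * S / 64 * ((17 * 64) / S))).
    suff -> : S * S / 64 * (17 * 64 / S) = 17 * S by [].
    by field; rewrite gt_eqF.
  by rewrite ler_wpM2r // divr_ge0 // ltW.
move: diff; rewrite ler_norml => /andP[d1 d2].
have hden := hd _ den_ge; have hnum := hd _ num_ge.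
have rec' : den * B' = num * B by [].
split.
  rewrite -(ler_pM2l (_ : 0 < den)); last by lra.
  rewrite rec'; set H := (17 * 64) / S in hden hnum *.
  have : (num - den + den * H) * B >= 0 by apply: mulr_ge0 => //; lra.
  by lra.
rewrite -(ler_pM2l (_ : 0 < num)); last by lra.
rewrite -rec'; set H := (17 * 64) / S in hden hnum *.
have : (den - num + num * H) * B' >= 0 by apply: mulr_ge0 => //; lra.
by lra.
Qed.

Lemma central_between y z k : central y -> central z ->
  (y <= k <= z)%N -> central k.
Proof.
rewrite /central !ler_norml => /andP[y1 y2] /andP[z1 z2] /andP[].
by rewrite -(ler_nat R) -[(k <= z)%N](ler_nat R) => *; apply/andP; split; lra.
Qed.

Lemma binom_pmf_iter k y : central y -> central (y + k) ->
  (1 - h) ^+ k * b y <= b (y + k) /\ (1 - h) ^+ k * b (y + k) <= b y.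
Proof.
have /andP[h0 h1] := h_bounds; have q0 : 0 <= 1 - h by lra.
elim: k => [|k IH] cy ck; first by rewrite addn0 expr0 !mul1r.
have ck' : central (y + k).
  by apply: central_between cy ck _; rewrite leq_addr addnS leqnSn.
have [I1 I2] := IH cy ck'; rewrite addnS in ck *.
have [r1 r2] := binom_pmf_ratio ck' ck.
rewrite exprS; split.
  by rewrite -mulrA; apply: le_trans r1; rewrite ler_wpM2l.
by rewrite mulrC mulrA mulrC -[X in _ * X]mulrC; apply: le_trans I2; rewrite ler_wpM2l ?exprn_ge0.
Qed.

(* Two central values differ by at most 32 s^2, and each unit step costs a
   factor at least 1 - h >= exp (- 2 h), where h = 17 * 64 / s^2. *)
Definition kappa : R := expR (- (64 * (17 * 64))).

Lemma binom_pmf_compare y z : central y -> central z -> kappa * b y <= b z.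
Proof.
have /andP[h0 h1] := h_bounds; have q0 : 0 <= 1 - h by lra.
have s2 : 0 < s ^+ 2 by have := s_large; lra.
have key k w : k%:R <= 32 * s ^+ 2 -> 0 <= w -> kappa * w <= (1 - h) ^+ k * w.
  move=> ks w0; rewrite ler_wpM2r //.
  apply: (@le_trans _ _ (expR (- (2 * h)) ^+ k)); last first.
    by apply: lerXn2r; rewrite ?nnegrE ?expR_ge0 //; apply: expR_le_oneB.
  rewrite -expRM_natr ler_expR mulNr lerN2.
  apply: (@le_trans _ _ (2 * h * (32 * s ^+ 2))); first by rewrite ler_wpM2l //; lra.
  suff -> : 2 * h * (32 * s ^+ 2) = 64 * (17 * 64) by [].
  by rewrite /h; field; exact: s_neq0.
have bd u v : central u -> central v -> (v%:R - u%:R : R) <= 32 * s ^+ 2.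
  by rewrite /central !ler_norml => /andP[? ?] /andP[? ?]; lra.
move=> cy cz; have [yz|/ltnW zy] := leqP y z.
  have ks := bd _ _ cy cz; rewrite -natrB // in ks.
  apply: le_trans (key _ _ ks (binom_pmf_ge0 p01' _ _)) _.
  by rewrite -{2}(subnKC yz); apply: (binom_pmf_iter cy _).1; rewrite subnKC.
have ks := bd _ _ cz cy; rewrite -natrB // in ks.
apply: le_trans (key _ _ ks (binom_pmf_ge0 p01' _ _)) _.
by rewrite -{2}(subnKC zy); apply: (binom_pmf_iter cz _).2; rewrite subnKC.
Qed.

(** The binomial tail with rate [(s ^+ 2)^-1] has exponent at most 1 - 16, well below what one half
    requires. *)
Lemma central_mass : 1 / 2 <= Pr p (fun S : {set E} => central #|S :&: F|).
Proof.
have s2 : 0 < s ^+ 2 by have := s_large; lra.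
have /andP[M1 M2] := mean_bounds.
have := PrC p (fun S : {set E} => central #|S :&: F|).
suff : Pr p (fun S : {set E} => ~~ central #|S :&: F|) <= 1 / 2 by lra.
have l01 : 0 <= (s ^+ 2)^-1 <= (1 / 3 : R).
  by rewrite invr_ge0 ltW //= mul1r lef_pV2 ?posrE //; have := s_large; lra.
apply: le_trans (le_trans _ (binomial_tail p01' F (16 * s ^+ 2) l01)) _.
  by apply: le_Pr => // S; rewrite /central -ltNge => /ltW.
have -> : (s ^+ 2)^-1 * (16 * s ^+ 2) = 16 by field; exact: s_neq0.
apply: (@le_trans _ _ (2 * expR (- 3))).
  rewrite ler_wpM2l // ler_expR.
  suff : p * (s ^+ 2)^-1 ^+ 2 * m <= 1 by lra.
  have -> : p * (s ^+ 2)^-1 ^+ 2 * m = p * m / s ^+ 4.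
    by field; exact: s_neq0.
  by rewrite ler_pdivrMr ?mul1r // -[4%N]/(2 * 2)%N exprM exprn_gt0.
have := expR_ge1Dx (3 : R); rewrite expRN => h3.
have : (expR 3)^-1 <= (4 : R)^-1 by rewrite lef_pV2 ?posrE ?expR_gt0 //; lra.
by lra.
Qed.

Lemma central_card n :
  (#|[pred i : 'I_n | central i]|)%:R <= 33 * s ^+ 2.
Proof.
have s2 : 0 < s ^+ 2 by have := s_large; lra.
have /andP[M1 M2] := mean_bounds.
set a := p * m - 16 * s ^+ 2.
(* [Num.truncn] is the floor only on nonnegative reals. *)
have a0 : 0 <= a.
  have s4 : s ^+ 4 = s ^+ 2 * s ^+ 2 by rewrite -exprD.
  by move: M1 s_large; rewrite /a subr_ge0 s4; nra.
have L0 : 0 <= 32 * s ^+ 2 by lra.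
have /andP[t1 t2] := truncn_itv a0; have /andP[u1 u2] := truncn_itv L0.
apply: (@le_trans _ _ ((Num.truncn (32 * s ^+ 2) + 2)%:R)); last by rewrite natrD; have := s_large; lra.
rewrite ler_nat; apply: leq_trans (card_ord_interval n (Num.truncn a) _).
apply: subset_leq_card; apply/fintype.subsetP => i; rewrite !inE /central ler_norml.
move=> /andP[i1 i2]; rewrite -ltnS -!(ltr_nat R) -[i.+1%:R]natr1 !natrD.
have {}t2 : a < (Num.truncn a)%:R + 1 by rewrite natr1.
have {}u2 : 32 * s ^+ 2 < (Num.truncn (32 * s ^+ 2))%:R + 1 by rewrite natr1.
by apply/andP; split; rewrite /a in t1 t2; lra.
Qed.

Definition local_const : R := kappa / 66.

Lemma local_const_gt0 : 0 < local_const.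
Proof. by rewrite divr_gt0 ?expR_gt0. Qed.

(** Mass at least 1/2 is spread over at most [33 * s ^+ 2] central values, none of which exceeds
    [b y / kappa]; hence the 66 in [local_const]. *)
Lemma binom_pmf_lower y : central y -> local_const / s ^+ 2 <= b y.
Proof.
move=> cy; have s2 : 0 < s ^+ 2 by have := s_large; lra.
have := central_mass; rewrite -(binom_pmf_sum p F central) => mass.
have : kappa * (1 / 2) <= 33 * s ^+ 2 * b y.
  apply: le_trans (ler_wpM2l (expR_ge0 _) mass) _; rewrite mulr_sumr.
  apply: (@le_trans _ _ (\sum_(i < #|E|.+1 | central i) b y)).
    by apply: ler_sum => i ci; apply: binom_pmf_compare.
  have -> : \sum_(i < #|E|.+1 | central i) b y =
      b y *+ #|[pred i : 'I_#|E|.+1 | central i]| by rewrite -sumr_const; apply: eq_bigl.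
  rewrite -[b y *+ _]mulr_natl ler_wpM2r ?binom_pmf_ge0 //.
  exact: central_card.
by rewrite ler_pdivrMr // /local_const; lra.
Qed.

(** The next value carries at least half as much mass, and the two masses sum to at most 1. *)
Lemma binom_pmf_upper y : central y -> central y.+1 -> b y <= 2 / 3.
Proof.
move=> cy cy1; have := binom_pmf_add_le1 p01' F y.
have [+ _] := binom_pmf_ratio cy cy1; have := binom_pmf_ge0 p01' F y.
by have /andP[h0 h1] := h_bounds; nra.
Qed.

End LocalLimit.

(** * Bounded differences *)

Section BlockConcentration.
Variables (R : realType) (E : finType) (p : R).
Hypothesis p01 : 0 <= p <= 1.
Implicit Types (G S F : {set E}) (f g : {set E} -> R).
Local Notation Ex := (Ex p).
Local Notation Pr := (Pr p).

Definition condEx F f G : R := Ex (fun S => f (mix F G S)).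

(** The tower property. The sets may overlap: the draw on [F2] overwrites the one on [F1]. *)
Lemma condExU F1 F2 f G :
  condEx (F1 :|: F2) f G = condEx F1 (condEx F2 f) G.
Proof.
rewrite /condEx (Ex_mix p F2); apply: eq_Ex => S; apply: eq_Ex => S'.
congr f; apply/setP => e; rewrite !in_mix !inE.
by case: (e \in F1); case: (e \in F2).
Qed.

(** Redrawing one block keeps [f] within [c] of its conditional mean. In the quadratic bound of the
    exponential the linear term then averages to zero. *)
Lemma condEx_exp_le F f G (c l : R) : 0 <= c -> 0 <= l -> l * c <= 1 / 3 ->
  (forall G S, `|f (mix F G S) - f G| <= c) ->
  condEx F (fun S => expR (- (l * f S))) G <=
    expR (l ^+ 2 * c ^+ 2 - l * condEx F f G).
Proof.
move=> c0 l0 lc lip; set mu := condEx F f G.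
have dev S : `|f (mix F G S) - mu| <= c.
  rewrite -[f (mix F G S)](Ex_cst E p) -ExB.
  apply: le_trans (abs_Ex_le p01 _) _; rewrite -[leRHS](Ex_cst E p).
  apply: le_Ex => // S'; rewrite distrC.
  have -> : mix F G S' = mix F (mix F G S) S'; last exact: lip.
  by apply/setP => e; rewrite !in_mix; case: (e \in F).
rewrite expRD [leRHS]mulrC.
apply: (@le_trans _ _ (expR (- (l * mu)) *
    Ex (fun S => 1 + - l * (f (mix F G S) - mu) + l ^+ 2 * c ^+ 2))).
  rewrite -ExZ; apply: le_Ex => // S.
  have -> : - (l * f (mix F G S)) = - (l * mu) + - l * (f (mix F G S) - mu) by ring.
  rewrite expRD ler_wpM2l ?expR_ge0 //.
  have dS : `|- l * (f (mix F G S) - mu)| <= l * c.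
    by rewrite normrM normrN (ger0_norm l0) ler_wpM2l.
  apply: le_trans (expR_le_quadratic (le_trans dS lc)) _.
  rewrite lerD2l -exprMn -real_normK ?num_real //.
  by apply: lerXn2r; rewrite ?nnegrE // mulr_ge0.
rewrite ler_wpM2l ?expR_ge0 // ExD Ex_cst ExD Ex_cst ExZ ExB Ex_cst subrr mulr0 addr0.
exact: expR_ge1Dx.
Qed.

(** Induction on the blocks: the induction hypothesis handles all but the first, and the one-block
    bound applies to the conditional expectation [h] over these, which inherits the Lipschitz
    constant. *)
Lemma condEx_exp_bigcup_le (I : eqType) (r : seq I) (F : I -> {set E}) f G (c l : R) :
  0 <= c -> 0 <= l -> l * c <= 1 / 3 ->
  (forall i G S, i \in r -> `|f (mix (F i) G S) - f G| <= c) ->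
  condEx (\bigcup_(i <- r) F i) (fun S => expR (- (l * f S))) G <=
    expR ((size r)%:R * (l ^+ 2 * c ^+ 2) - l * condEx (\bigcup_(i <- r) F i) f G).
Proof.
move=> c0 l0 lc; elim: r G => [|i r IH] G lip.
  rewrite big_nil mul0r add0r.
  have mix0 S : mix finset.set0 G S = G.
    by apply/setP => e; rewrite in_mix finset.in_set0.
  rewrite /condEx; under eq_Ex do rewrite mix0.
  by under [in leRHS]eq_Ex do rewrite mix0; rewrite !Ex_cst.
rewrite big_cons !condExU; set U := \bigcup_(i <- r) F i; set h := condEx U f.
apply: (@le_trans _ _ (expR ((size r)%:R * (l ^+ 2 * c ^+ 2)) *
    condEx (F i) (fun S => expR (- (l * h S))) G)).
  rewrite -ExZ; apply: le_Ex => // S; rewrite -expRD.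
  by apply: IH => j ? ? jr; apply: lip; rewrite inE jr orbT.
rewrite /= -natr1 mulrDl mul1r -addrA expRD ler_wpM2l ?expR_ge0 //.
apply: condEx_exp_le => // G' S; rewrite -ExB.
apply: le_trans (abs_Ex_le p01 _) _; rewrite -[leRHS](Ex_cst E p).
apply: le_Ex => // S'.
(* Both terms use the same draw [S'] on [U], so their arguments still differ only inside [F i]. *)
have -> : mix U (mix (F i) G' S) S' = mix (F i) (mix U G' S') (mix U S S').
  by apply/setP => e; rewrite !in_mix; case: (e \in F i); case: (e \in U).
by apply: lip; rewrite mem_head.
Qed.

(** Chernoff's method. Since [f] is determined by the blocks, its conditional expectation from any
    starting set, here the empty one, is its expectation. *)
Lemma bounded_difference_lower_tail (I : eqType) (r : seq I) (F : I -> {set E}) f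
    (c l D : R) : 0 <= c -> 0 <= l -> l * c <= 1 / 3 ->
  (forall i G S, i \in r -> `|f (mix (F i) G S) - f G| <= c) ->
  (forall G S, f (mix (\bigcup_(i <- r) F i) G S) = f S) ->
  Pr (fun S => f S <= Ex f - D) <=
    expR ((size r)%:R * (l ^+ 2 * c ^+ 2) - l * D).
Proof.
move=> c0 l0 lc lip fU.
have fUE : condEx (\bigcup_(i <- r) F i) f finset.set0 = Ex f.
  by apply: eq_Ex => S; rewrite fU.
apply: (@le_trans _ _ (Ex (fun S => expR (l * (Ex f - D)) * expR (- (l * f S))))).
  apply: (markov p01) => G; first by rewrite mulr_ge0 ?expR_ge0.
  move=> fG; rewrite -expRD; apply: le_trans (expR_ge1Dx _).
  by rewrite lerDl -mulrBr mulr_ge0 // subr_ge0.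
rewrite ExZ; have := condEx_exp_bigcup_le finset.set0 c0 l0 lc lip.
rewrite fUE /condEx; under eq_Ex do rewrite fU.
move=> h; apply: le_trans (ler_wpM2l (expR_ge0 _) h) _.
by rewrite -expRD ler_expR; lra.
Qed.

End BlockConcentration.

(** * Anti-concentration *)

Section AntiConcentration.
Variables (R : realType) (E : finType) (p : R).
Hypothesis p01 : 0 <= p <= 1.
Variables (I : eqType) (F : I -> {set E}) (Z : I -> pred {set E}).
Hypothesis F_disj : forall i j, i != j -> [disjoint F i & F j].
Hypothesis Z_block : forall i (G S : {set E}), (forall e, e \in F i -> (e \in G) = (e \in S)) ->
  Z i G = Z i S.
Local Notation Ex := (Ex p).
Local Notation Pr := (Pr p).

Definition count_events (r : seq I) (S : {set E}) : R := \sum_(i <- r) (Z i S)%:R.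

(* The squared modulus of the characteristic function of the count. *)
Lemma char_fun_count (r : seq I) (t : R) : uniq r ->
  Ex (fun S => cos (t * count_events r S)) ^+ 2 +
  Ex (fun S => sin (t * count_events r S)) ^+ 2 =
  \prod_(i <- r) (1 - 2 * (Pr (Z i) * (1 - Pr (Z i))) * (1 - cos t)).
Proof.
elim: r => [|i r IH] => [_|/= /andP[ir /IH {}IH]].
  rewrite big_nil /count_events; under eq_Ex do rewrite big_nil mulr0 cos0.
  under [X in _ + X ^+ 2]eq_Ex do rewrite big_nil mulr0 sin0.
  by rewrite !Ex_cst expr1n expr0n addr0.
set C := Ex _ in IH; set D := Ex (fun S => sin _) in IH.
rewrite big_cons -IH; set q := Pr (Z i).
have cnt_mix G S : count_events r (mix (F i) G S) = count_events r G.
  rewrite /count_events !big_seq; apply: eq_bigr => j jr; congr (_%:R).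
  congr nat_of_bool; apply: Z_block => e eF; rewrite in_mix.
  have ij : j != i by apply: contraNneq ir => <-.
  by rewrite (disjointFr (F_disj ij) eF).
have Z_mix G S : Z i (mix (F i) G S) = Z i S.
  by apply: Z_block => e eF; rewrite in_mix eF.
have indep g : Ex (fun S => (Z i S)%:R * g (count_events r S)) =
    q * Ex (fun S => g (count_events r S)).
  by apply: (@Ex_indep _ _ p (F i)) => G S; rewrite ?Z_mix ?cnt_mix.
(* This and the next identity are the real and imaginary parts of multiplying [C + i D] by
   [1 + q (e^(it) - 1)], the characteristic function of the new indicator. *)
have -> : Ex (fun S => cos (t * count_events (i :: r) S)) =
    C + q * ((cos t - 1) * C - sin t * D).
  rewrite -!ExZ -ExB -(indep (fun x => (cos t - 1) * cos (t * x) - sin t * sin (t * x))) -ExD.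
  apply: eq_Ex => S; rewrite /count_events big_cons mulrDr cosD.
  by case: (Z i S); rewrite ?mulr1 ?mulr0 ?mul1r ?mul0r ?cos0 ?sin0; ring.
have -> : Ex (fun S => sin (t * count_events (i :: r) S)) =
    D + q * ((cos t - 1) * D + sin t * C).
  rewrite -!ExZ -ExD -(indep (fun x => (cos t - 1) * sin (t * x) + sin t * cos (t * x))) -ExD.
  apply: eq_Ex => S; rewrite /count_events big_cons mulrDr sinD.
  by case: (Z i S); rewrite ?mulr1 ?mulr0 ?mul1r ?mul0r ?cos0 ?sin0; ring.
have ct := cos2Dsin2 t; set x := cos t in ct *; set y := sin t in ct *.
have y2 : y ^+ 2 = 1 - x ^+ 2 by rewrite -ct; ring.
transitivity ((C ^+ 2 + D ^+ 2) * ((1 + q * (x - 1)) ^+ 2 + q ^+ 2 * y ^+ 2)).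
  by ring.
by rewrite y2; ring.
Qed.

(* [|y| >= (1 - cos (t y)) / t], and the mean of [cos (t (X - b))] is at most
   the modulus of the characteristic function of X, whatever b is. *)
Lemma mean_abs_dev_ge (r : seq I) (t rho b : R) : uniq r -> 0 < t -> 0 <= rho ->
  \prod_(i <- r) (1 - 2 * (Pr (Z i) * (1 - Pr (Z i))) * (1 - cos t)) <= rho ^+ 2 ->
  (1 - rho) / t <= Ex (fun S => `|count_events r S - b|).
Proof.
move=> ur t0 rho0; rewrite -char_fun_count // => chi.
set C := Ex (fun S => cos _) in chi; set D := Ex (fun S => sin _) in chi.
have cos_shift : Ex (fun S => cos (t * (count_events r S - b))) =
    cos (t * b) * C + sin (t * b) * D.
  rewrite -!ExZ -ExD; apply: eq_Ex => S; rewrite mulrBr cosB.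
  by rewrite mulrC [sin _ * _]mulrC.
have : cos (t * b) * C + sin (t * b) * D <= rho.
  have := cos2Dsin2 (t * b); set x := cos _; set y := sin _ => xy.
  (* Cauchy-Schwarz, through the Lagrange identity. *)
  have h : (x * C + y * D) ^+ 2 <= rho ^+ 2.
    have : 0 <= (x * D - y * C) ^+ 2 := sqr_ge0 _.
    have -> : (x * D - y * C) ^+ 2 =
      (x ^+ 2 + y ^+ 2) * (C ^+ 2 + D ^+ 2) - (x * C + y * D) ^+ 2 by ring.
    by rewrite xy mul1r subr_ge0 => h; apply: le_trans h chi.
  by have := ler_norm (x * C + y * D); move: h; rewrite -ler_sqrt ?sqr_ge0 // !sqrtr_sqr (ger0_norm rho0); lra.
rewrite -cos_shift => cb; rewrite ler_pdivrMr // -ExZr.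
apply: (@le_trans _ _ (Ex (fun S => 1 - cos (t * (count_events r S - b))))).
  by rewrite ExB Ex_cst; lra.
apply: le_Ex => // S; apply: le_trans (one_sub_cos_le _) _.
by rewrite normrM (gtr0_norm t0) mulrC.
Qed.

End AntiConcentration.

(** * Discrepancy over a window of values *)

Section WindowDiscrepancy.
Variables (R : realType) (E : finType) (p : R).
Hypothesis p01 : 0 < p <= 1 / 2.
Variables (I : finType) (A : {set I}) (F : I -> {set E}) (m : nat) (c : I -> nat).
Variables (J : nat) (x : 'I_J -> nat) (b : 'I_J -> R) (s : R).
Local Notation Ex := (Ex p).
Local Notation Pr := (Pr p).

(** Bounds the modulus of the characteristic function at [1 / s]: 8 comes from [one_sub_cos_ge], and
    48 is 16 * 3, from the [s ^+ 4 / 16] useful vertices and [1 - q >= 1 / 3]. *)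
Definition char_fun_bound : R := expR (- (local_const R / (8 * 48))).
(** With at least [s ^+ 2 / 2] values in the window, [disc_const * s ^+ 3] is at most half of the
    mean discrepancy. *)
Definition disc_const : R := (1 - char_fun_bound) / 4.

Lemma disc_const_gt0 : 0 < disc_const.
Proof.
have lc : 0 < local_const R / (8 * 48) by rewrite divr_gt0 ?local_const_gt0 // mulr_gt0.
have : expR (- (local_const R / (8 * 48))) < 1 by rewrite expR_lt1 oppr_lt0.
by rewrite /disc_const /char_fun_bound; lra.
Qed.

Lemma disc_const_le1 : disc_const <= 1.
Proof. by have := expR_ge0 (- (local_const R / (8 * 48))); rewrite /disc_const /char_fun_bound; lra. Qed.

Hypothesis F_disj : forall i j, i != j -> [disjoint F i & F j].
Hypothesis F_card : forall i, i \in A -> #|F i| = m.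
Hypothesis x_inj : injective x.
Hypothesis s_large : 50 <= s.
Hypothesis mean_bounds : s ^+ 4 / 16 <= p * m%:R <= s ^+ 4.
Hypothesis J_large : s ^+ 2 / 2 <= J%:R.
Hypothesis A_small : #|A|%:R <= 2 * s ^+ 4.
Variable A0 : {set I}.
Hypothesis A0_sub : A0 \subset A.
Hypothesis A0_large : s ^+ 4 / 16 <= #|A0|%:R.
Hypothesis A0_centred : forall i j, i \in A0 ->
  `|(x j)%:R - (c i)%:R - p * m%:R| <= 15 * s ^+ 2.

(** Models the event that vertex [i] has degree [x j]: [c i] frozen edges, plus those present in
    [F i]. *)
Definition hit (j : 'I_J) (i : I) : pred {set E} :=
  fun S => (c i + #|S :&: F i| == x j)%N.

Definition discrepancy (S : {set E}) : R :=
  \sum_j `|\sum_(i in A) (hit j i S)%:R - b j|.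

Let p01' : 0 <= p <= 1.
Proof. by case/andP: p01 => ? ?; apply/andP; split; lra. Qed.

Lemma hit_block j i (G S : {set E}) : (forall e, e \in F i -> (e \in G) = (e \in S)) ->
  hit j i G = hit j i S.
Proof.
move=> GS; rewrite /hit; congr (_ + #|pred_of_set _| == _)%N.
by apply/setP => e; rewrite !inE; case: (boolP (e \in F i)) => [/GS ->|]; rewrite ?andbF.
Qed.

Lemma hit_prob j i : i \in A0 ->
  local_const R / s ^+ 2 <= Pr (hit j i) /\ Pr (hit j i) <= 2 / 3.
Proof.
move=> iA0; have iA := fintype.subsetP A0_sub _ iA0.
have s2 : 50 * 50 <= s ^+ 2 by have := s_large; nra.
have := A0_centred j iA0; rewrite ler_norml => /andP[d1 d2].
have /andP[M1 M2] := mean_bounds.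
have s4 : s ^+ 4 = s ^+ 2 * s ^+ 2 by rewrite -exprD.
(* Needed for the truncated subtraction [x j - c i]: the mean, at least [s ^+ 4 / 16], outweighs the
   error [15 * s ^+ 2]. *)
have cx : (c i <= x j)%N.
  rewrite -(ler_nat R); rewrite s4 in M1.
  have : 15 * s ^+ 2 <= s ^+ 2 * s ^+ 2 / 16 by nra.
  by lra.
have -> : Pr (hit j i) = binom_pmf p (F i) (x j - c i).
  by apply: eq_Ex => S; rewrite /hit -{1}(subnKC cx) eqn_add2l.
have cen : central p (F i) s (x j - c i).
  by rewrite /central F_card // natrB // ler_norml; apply/andP; split; lra.
have cen1 : central p (F i) s (x j - c i).+1.
  by rewrite /central F_card // -natr1 natrB // ler_norml; apply/andP; split; lra.
by split; [apply: binom_pmf_lower|apply: binom_pmf_upper cen cen1];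
  rewrite // F_card.
Qed.

(** At [t = s^-1] each vertex of [A0] contributes a factor [exp (- K)] with [K] of order [s ^- 4],
    and [A0] has order [s ^+ 4] vertices; the squared modulus is therefore bounded away from 1. *)
Lemma mean_hit_dev_ge j :
  (1 - char_fun_bound) * s <= Ex (fun S => `|\sum_(i in A) (hit j i S)%:R - b j|).
Proof.
have s0 : 0 < s by have := s_large; lra.
have -> : Ex (fun S => `|\sum_(i in A) (hit j i S)%:R - b j|) =
    Ex (fun S => `|count_events R (hit j) (enum A) S - b j|).
  by apply: eq_Ex => S; rewrite /count_events big_enum.
have -> : (1 - char_fun_bound) * s = (1 - char_fun_bound) / s^-1 by rewrite invrK.
apply: (mean_abs_dev_ge p01' F_disj) => //.
- by move=> i G S; apply: hit_block.
- exact: enum_uniq.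
- by rewrite invr_gt0.
- exact: expR_ge0.
have t01 : 0 <= s^-1 <= 1.
  by rewrite invr_ge0 ltW //= invf_le1 //; have := s_large; lra.
have ct := one_sub_cos_ge t01; set ctt := 1 - cos _ in ct *.
have ct2 : ctt <= 2 by have := cos_geN1 s^-1; rewrite /ctt; lra.
have ct0 : 0 <= ctt by apply: le_trans ct; rewrite divr_ge0 ?sqr_ge0.
set q := fun i => Pr (hit j i).
have q01 i : 0 <= q i <= 1 by rewrite Pr_ge0 ?Pr_le1.
have qq i : 0 <= q i * (1 - q i) <= 1 / 4.
  have /andP[? ?] := q01 i; rewrite mulr_ge0 ?subr_ge0 //=.
  by have := sqr_ge0 (q i - 1 / 2); lra.
rewrite big_enum /=.
apply: (@le_trans _ _ (\prod_(i in A) expR (- (2 * (q i * (1 - q i)) * ctt)))).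
  apply: ler_prod => i _; apply/andP; split.
    rewrite -/(q i); have /andP[] := qq i; set w := q i * _ => w0 w1.
    by nra.
  exact: expR_ge1Dx.
rewrite -expR_sum /char_fun_bound -expRM_natr ler_expR sumrN mulNr lerN2.
(* The factor 2 comes from the square of [char_fun_bound]; the right side is the least size of [A0]
   times the contribution [K] of one vertex. *)
have -> : local_const R / (8 * 48) * 2%:R =
    s ^+ 4 / 16 * (2 * (local_const R / s ^+ 2 / 3) * (s^-1 ^+ 2 / 8)).
  by field; rewrite gt_eqF.
set K := 2 * _ * _.
have lc0 := local_const_gt0 R.
have w0 : 0 <= local_const R / s ^+ 2 / 3.
  by rewrite divr_ge0 // divr_ge0 ?sqr_ge0 // ltW.
have v0 : 0 <= s^-1 ^+ 2 / 8 by rewrite divr_ge0 ?sqr_ge0.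
have K0 : 0 <= K by rewrite mulr_ge0 // mulr_ge0.
apply: (@le_trans _ _ (\sum_(i in A0) K)).
  by rewrite sumr_const -[_ *+ #|_|]mulr_natl ler_wpM2r.
apply: (@le_trans _ _ (\sum_(i in A0) 2 * (q i * (1 - q i)) * ctt)).
  apply: ler_sum => i iA0; rewrite /K.
  have [ql qu] := hit_prob j iA0; rewrite -/(q i) in ql qu.
  apply: ler_pM => //.
    by rewrite mulr_ge0.
  rewrite ler_wpM2l //; have /andP[? ?] := q01 i; nra.
rewrite [leRHS]big_mkcond [leLHS]big_mkcond; apply: ler_sum => i _.
case: ifP => [/(fintype.subsetP A0_sub) -> //|_]; case: ifP => // _.
by have /andP[? ?] := qq i; rewrite mulr_ge0 // mulr_ge0.
Qed.

(** Only the value taken by vertex [i] changes, and since [x] is injective it occupies at most one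
    position of the window before and one after. *)
Lemma discrepancy_lip i (G S : {set E}) : i \in A ->
  `|discrepancy (mix (F i) G S) - discrepancy G| <= 2.
Proof.
move=> iA; rewrite /discrepancy -sumrB.
apply: le_trans (ler_norm_sum _ _ _) _.
set G' := mix (F i) G S.
apply: (@le_trans _ _ (\sum_j ((hit j i G')%:R + (hit j i G)%:R))).
  apply: ler_sum => j _; apply: le_trans (ler_dist_dist _ _) _.
  rewrite opprB addrA subrK (bigD1 i) // [X in _ - X](bigD1 i) //=.
  have -> : \sum_(k in A | k != i) (hit j k G')%:R = \sum_(k in A | k != i) (hit j k G)%:R :> R.
    apply: eq_bigr => k /andP[_ ki]; congr (nat_of_bool _)%:R; apply: hit_block => e eF.
    by rewrite in_mix (disjointFr (F_disj ki) eF).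
  rewrite opprD addrACA subrr addr0.
  by case: (hit j i G'); case: (hit j i G); rewrite ?subrr ?subr0 ?sub0r ?normrN ?normr0 ?normr1 ?addr0 ?add0r //; lra.
rewrite big_split /=.
have once H : \sum_j (hit j i H)%:R <= 1 :> R.
  case: (pickP (fun j => hit j i H)) => [j hj|no]; last first.
    by rewrite big1 ?ler01 // => j _; rewrite no.
  rewrite (bigD1 j) //= hj big1 ?addr0 // => k kj.
  case: (boolP (hit k i H)) => // hk; case/eqP: kj; apply: x_inj.
  by rewrite -(eqP hk) -(eqP hj).
by have := once G; have := once G'; lra.
Qed.

Lemma discrepancy_tail :
  Pr (fun S => discrepancy S <= disc_const * s ^+ 3) <=
    expR (- (disc_const ^+ 2 / 32 * s ^+ 2)).
Proof.
have s0 : 0 < s by have := s_large; lra.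
have z0 := disc_const_gt0; have z1 := disc_const_le1.
have mean : 2 * (disc_const * s ^+ 3) <= Ex discrepancy.
  rewrite /discrepancy Ex_sum.
  apply: (@le_trans _ _ (\sum_(j < J) 4 * disc_const * s)); last first.
    apply: ler_sum => j _; apply: le_trans (mean_hit_dev_ge j).
    by rewrite /disc_const; lra.
  rewrite sumr_const card_ord -[_ *+ J]mulr_natl.
  have -> : 2 * (disc_const * s ^+ 3) = s ^+ 2 / 2 * (4 * disc_const * s) by field.
  have : 0 <= 4 * disc_const * s by nra.
  by move=> h; rewrite ler_wpM2r.
(* Minimises [8 * s ^+ 4 * l ^+ 2 - disc_const * s ^+ 3 * l], the exponent for at most [2 * s ^+ 4]
   blocks with differences at most 2. *)
set l := disc_const / (16 * s).
have l0 : 0 <= l by rewrite divr_ge0 ?(ltW z0) // mulr_ge0 ?(ltW s0).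
have l2 : l * 2 <= 1 / 3.
  rewrite /l -[_ * 2]mulrAC ler_pdivrMr ?mulr_gt0 //.
  by have := s_large; lra.
have lip i G S : i \in enum A -> `|discrepancy (mix (F i) G S) - discrepancy G| <= 2.
  by rewrite mem_enum; apply: discrepancy_lip.
have fU G S : discrepancy (mix (\bigcup_(i <- enum A) F i) G S) = discrepancy S.
  apply: eq_bigr => j _; congr (`|_ - _|); apply: eq_bigr => i iA.
  congr (nat_of_bool _)%:R; apply: hit_block => e eF; rewrite in_mix.
  suff -> : e \in \bigcup_(i <- enum A) F i by [].
  by rewrite big_enum; apply/bigcupP; exists i.
apply: le_trans (le_trans _ (bounded_difference_lower_tail p01' (disc_const * s ^+ 3) _ l0 l2 lip fU)) _ => //.
  by apply: le_Pr => // S; lra.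
rewrite ler_expR -cardE.
have lD : l * (disc_const * s ^+ 3) = disc_const ^+ 2 * s ^+ 2 / 16.
  by rewrite /l; field; rewrite gt_eqF.
have : #|A|%:R * (l ^+ 2 * 2 ^+ 2) <= 2 * s ^+ 4 * (l ^+ 2 * 2 ^+ 2).
  by rewrite ler_wpM2r // mulr_ge0 // sqr_ge0.
have -> : 2 * s ^+ 4 * (l ^+ 2 * 2 ^+ 2) = disc_const ^+ 2 * s ^+ 2 / 32.
  by rewrite /l; field; rewrite gt_eqF.
by lra.
Qed.

End WindowDiscrepancy.

(** * Degree neighbourhoods *)

Section DegreeMultisets.

(** Values outside both supports contribute zero; the others are distinct terms of the defining
    sum. *)
Lemma msymdiff_size_ge (A B : multiset nat) (J : nat) (x : 'I_J -> nat) :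
  injective x ->
  (\sum_j `|(A (x j))%:Z - (B (x j))%:Z| <= msymdiff_size A B)%N.
Proof.
move=> xinj; rewrite /msymdiff_size; set U := (_ `|` _)%fset.
pose g y := `|(A y)%:Z - (B y)%:Z|%N.
have g0 y : y \notin U -> g y = 0%N.
  rewrite in_fsetU negb_or !memNfinsupp => /andP[/eqP a0 /eqP b0].
  by rewrite /g a0 b0.
have -> : (\sum_j g (x j) = \sum_(y <- [seq x j | j <- enum 'I_J]) g y)%N.
  by rewrite big_map big_enum.
have us : uniq [seq x j | j <- enum 'I_J] by rewrite map_inj_uniq ?enum_uniq.
set s := [seq _ | _ <- _] in us *.
rewrite (bigID (fun y => y \in U)) /= [X in (_ + X)%N]big1 ?addn0 => [|y /g0 //].
have -> : (\sum_(y <- s | y \in U) g y = \sum_(y <- U | y \in s) g y)%N.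
  rewrite -big_filter -[RHS]big_filter; apply: perm_big; apply: uniq_perm.
  - by rewrite filter_uniq.
  - by rewrite filter_uniq ?fset_uniq.
  by move=> y; rewrite !mem_filter andbC.
by rewrite [leqRHS](bigID (fun y => y \in s)) leq_addr.
Qed.

Lemma deg_nbhdE (R : realType) n (G : graph n) (m : R) (u : 'I_n) (x : nat) :
  x%:R <= m -> deg_nbhd G m u x = #|[set w in nbrs G u | deg G w == x]|.
Proof.
move=> xm; rewrite /deg_nbhd mset_seqE count_map count_filter -sum1_count.
rewrite -sum1_card big_enum_cond /=; apply: eq_bigl => w; rewrite [RHS]inE.
by case: (w \in _) => //=; case: eqP => //= ->; rewrite xm.
Qed.

End DegreeMultisets.

(** * Edges from a vertex to a set of vertices *)

Section Spokes.
Variable n : nat.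
Implicit Types (G S F : graph n) (a b w : 'I_n) (W : {set 'I_n}).

Definition spokes a W : {set vpair n} :=
  [set e : vpair n | [exists w in W, val e == [set a; w]]].

Lemma adjP G a b : reflect (exists2 e : vpair n, e \in G & val e = [set a; b]) (adj G a b).
Proof.
apply: (iffP existsP) => [[e /andP[eG /eqP eE]]|[e eG eE]]; first by exists e.
by exists e; rewrite eG eE eqxx.
Qed.

Lemma adj_sym G a b : adj G a b = adj G b a.
Proof. by rewrite /adj finset.setUC. Qed.

Lemma adj_irrefl G a : adj G a a = false.
Proof.
apply/negbTE/negP => /adjP[e _ eE]; have := valP e.
by rewrite eE cards2 eqxx.
Qed.

Lemma adj_eq G S a b : (forall e : vpair n, val e = [set a; b] -> (e \in G) = (e \in S)) ->
  adj G a b = adj S a b.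
Proof.
by move=> GS; apply/adjP/adjP => -[e eG eE]; exists e; rewrite // ?GS // -GS.
Qed.

Lemma adj_mix F G S a b (c : bool) :
  (forall e : vpair n, val e = [set a; b] -> (e \in F) = c) ->
  adj (mix F G S) a b = if c then adj S a b else adj G a b.
Proof.
by move=> Fc; case: c Fc => Fc; apply: adj_eq => e eE; rewrite in_mix Fc.
Qed.

Lemma pair_inj a b w : [set a; b] = [set a; w] -> b = w.
Proof.
move=> eq; have : b \in [set a; w] by rewrite -eq !inE eqxx orbT.
rewrite !inE => /orP[/eqP ba|/eqP //]; subst b.
have : w \in [set a; a] by rewrite eq !inE eqxx orbT.
by rewrite !inE orbb => /eqP ->.
Qed.

(** An edge at [a] is determined by its other end. This makes the number of neighbours of [a] in [W]
    a binomial variable. *)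
Lemma card_spokesI S a W : a \notin W -> #|S :&: spokes a W| = #|nbrs S a :&: W|.
Proof.
move=> aW; rewrite -(card_imset _ val_inj).
rewrite -(@card_in_imset _ _ (fun w => [set a; w]) (nbrs S a :&: W)); last first.
  by move=> w w' _ _; apply: pair_inj.
congr #|pred_of_set _|; apply/setP => A; apply/imsetP/imsetP => [[e]|[w]].
  rewrite !inE => /andP[eS /existsP[w /andP[wW /eqP eE]]] ->; exists w => //.
  by rewrite !inE wW andbT; apply/adjP; exists e.
rewrite !inE => /andP[/adjP[e eS eE] wW] ->; exists e => //.
by rewrite !inE eS; apply/existsP; exists w; rewrite wW eE eqxx.
Qed.

Lemma card_spokes a W : a \notin W -> #|spokes a W| = #|W|.
Proof.
move=> aW; rewrite -(finset.setTI (spokes a W)) card_spokesI //.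
congr #|pred_of_set _|; apply/finset.setIidPr; apply/fintype.subsetP => w wW.
have aw : #|[set a; w]| == 2%N by rewrite cards2 (contraNneq _ aW) // => ->.
by rewrite inE; apply/adjP; exists (Sub [set a; w] aw); rewrite ?inE ?SubK.
Qed.

Lemma mem_spokes a W w (e : vpair n) : val e = [set a; w] -> w \in W -> e \in spokes a W.
Proof. by move=> eE wW; rewrite inE; apply/existsP; exists w; rewrite wW eE eqxx. Qed.

Lemma nbrs_mixI F G S a W : (forall w (e : vpair n), w \in W -> val e = [set a; w] -> e \notin F) ->
  nbrs (mix F G S) a :&: W = nbrs G a :&: W.
Proof.
move=> h; apply/setP => w; rewrite !inE; case: (boolP (w \in W)) => wW; rewrite ?andbF //.
by rewrite !andbT (@adj_mix F G S a w false) // => e eE; apply/negbTE; apply: h eE.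
Qed.

Lemma nbrs_mixI_in F G S a W : (forall w (e : vpair n), w \in W -> val e = [set a; w] -> e \in F) ->
  nbrs (mix F G S) a :&: W = nbrs S a :&: W.
Proof.
move=> h; apply/setP => w; rewrite !inE; case: (boolP (w \in W)) => wW; rewrite ?andbF //.
by rewrite !andbT (@adj_mix F G S a w true) // => e eE; apply: h eE.
Qed.

Lemma nbrs_mix F G S a : (forall w (e : vpair n), val e = [set a; w] -> e \notin F) ->
  nbrs (mix F G S) a = nbrs G a.
Proof.
move=> h; rewrite -[LHS]finset.setIT -[RHS]finset.setIT.
by apply: nbrs_mixI => w e _; apply: h.
Qed.

End Spokes.

(** * A pair of vertices *)

Section VertexPair.
Variables (R : realType) (n : nat) (p s : R) (u v : 'I_n).
Hypothesis uv : u != v.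
Hypothesis p01 : 0 < p <= 1 / 2.
Hypothesis mean_deg : p * n%:R = s ^+ 4.
Hypothesis s_large : 50 <= s.
Implicit Types (G S : graph n) (a w : 'I_n).
Local Notation Pr := (@Pr R (vpair n) p).

(** Leaving out [u] and [v] makes the sets below independent of whether [u] and [v] are adjacent. *)
Definition others : {set 'I_n} := ~: [set u; v].
Definition non_nbrs G : {set 'I_n} := others :\: nbrs G v.
Definition private_nbrs G : {set 'I_n} := nbrs G u :&: non_nbrs G.
Definition isolated_from_pair G : {set 'I_n} := non_nbrs G :\: nbrs G u.
Local Notation A := private_nbrs.
Local Notation W := isolated_from_pair.

Let p01' : 0 <= p <= 1.
Proof. by case/andP: p01 => ? ?; apply/andP; split; lra. Qed.

Let s2_large : 50 * 50 <= s ^+ 2.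
Proof. by have := s_large; nra. Qed.

Let s4E : s ^+ 4 = s ^+ 2 * s ^+ 2.
Proof. by rewrite -exprD. Qed.

Let n_large : 2 * s ^+ 4 <= n%:R.
Proof.
have /andP[p0 ph] := p01; have := mean_deg; have : 0 <= n%:R :> R by apply: ler0n.
by nra.
Qed.

Lemma card_others : #|others|%:R = n%:R - 2 :> R.
Proof.
have := cardsC [set u; v]; rewrite cards2 uv card_ord => h.
have : (2 + #|others|)%:R = n%:R :> R by congr (_%:R).
by rewrite natrD; lra.
Qed.

(** * Sizes of the sets A and W *)

Definition typical_v G : bool :=
  `|#|nbrs G v :&: others|%:R - p * #|others|%:R| < n%:R / 8.

Lemma v_notin_others : v \notin others.
Proof. by rewrite !inE eqxx orbT. Qed.

Lemma u_notin_others : u \notin others.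
Proof. by rewrite !inE eqxx. Qed.

Lemma typical_v_tail : Pr (fun G => ~~ typical_v G) <= 2 * expR (- (n%:R / 128)).
Proof.
have l01 : 0 <= (1 / 8 : R) <= 1 / 3 by apply/andP; split; lra.
apply: le_trans (le_trans _ (binomial_tail p01' (spokes v others) (n%:R / 8) l01)) _.
  apply: le_Pr => // G; rewrite /typical_v -leNgt card_spokesI ?v_notin_others //.
  by rewrite card_spokes ?v_notin_others.
rewrite ler_wpM2l // ler_expR card_spokes ?v_notin_others // card_others.
have /andP[p0 ph] := p01; have : p * n%:R <= 1 / 2 * n%:R by rewrite ler_wpM2r.
rewrite mulrBr expr2; lra.
Qed.

Definition typical_u G : bool :=
  `|#|A G|%:R - p * #|non_nbrs G|%:R| < p * #|non_nbrs G|%:R / 2.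

Lemma card_non_nbrs_ge G : typical_v G -> n%:R / 4 <= #|non_nbrs G|%:R :> R.
Proof.
rewrite /typical_v ltr_norml => /andP[_ t2].
have := cardsID (nbrs G v) others; rewrite finset.setIC => h.
have : #|nbrs G v :&: others|%:R + #|non_nbrs G|%:R = #|others|%:R :> R by rewrite -natrD h.
have /andP[p0 ph] := p01; have : p * n%:R <= 1 / 2 * n%:R by rewrite ler_wpM2r.
have := s2_large; have := n_large; rewrite s4E.
move: t2; rewrite card_others; nra.
Qed.

Definition good_sizes G : bool :=
  [&& s ^+ 4 / 8 <= #|A G|%:R, #|A G|%:R <= 2 * s ^+ 4 &
      (n%:R / 16 : R) <= #|W G|%:R].

(** With Z the set [non_nbrs G], the size of A is between [p|Z|/2] and [3p|Z|/2], where
    [n/4 <= |Z| <= n]. As [p <= 1/2], at least a quarter of Z is left for W. *)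
Lemma typical_good_sizes G : typical_v G -> typical_u G -> good_sizes G.
Proof.
move=> /card_non_nbrs_ge tv; rewrite /typical_u ltr_norml => /andP[t1 t2].
have : #|A G|%:R + #|W G|%:R = #|non_nbrs G|%:R :> R.
  by rewrite -natrD -(cardsID (nbrs G u) (non_nbrs G)) finset.setIC.
have : #|non_nbrs G|%:R <= n%:R :> R by rewrite ler_nat -[leqRHS]card_ord max_card.
have /andP[p0 ph] := p01 => Zn AW; have := mean_deg => md.
by apply/and3P; split; nra.
Qed.

(** Exposure in two stages: the edges at [v] determine [non_nbrs G], and given these the size of A
    is binomial in the edges from [u]. *)
Lemma good_sizes_tail :
  Pr (fun G => ~~ good_sizes G) <=
    2 * expR (- (n%:R / 128)) + 2 * expR (- (s ^+ 4 / 64)).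
Proof.
apply: le_trans (lerD typical_v_tail (_ : Pr (fun G => typical_v G && ~~ typical_u G) <= _)).
  apply: le_trans (PrU_le p01' _ _); apply: le_Pr => // G.
  have := @typical_good_sizes G.
  by case: (typical_v G); case: (typical_u G) => //= ->.
have Fv w (e : vpair n) : val e = [set v; w] -> e \notin spokes u others.
  move=> eE; rewrite !inE; apply/existsP => -[w' /andP[w'o /eqP eE']].
  have : v \in [set u; w'] by rewrite -eE' eE !inE eqxx.
  rewrite !inE eq_sym (negbTE uv) /= => /eqP vw'.
  by move: w'o; rewrite -vw' (negbTE v_notin_others).
have Nv G S : nbrs (mix (spokes u others) G S) v = nbrs G v.
  by apply: nbrs_mix => w e; apply: Fv.
apply: (Pr_cond_le p01' (F := fun=> spokes u others)) => //.
  by move=> G S; rewrite /typical_v Nv.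
move=> G tv; set Z := non_nbrs G.
have Zo : Z \subset others by apply: finset.subsetDl.
have uZ : u \notin Z by apply: contra u_notin_others; apply: (fintype.subsetP Zo).
have l01 : 0 <= (1 / 4 : R) <= 1 / 3 by apply/andP; split; lra.
apply: le_trans (le_trans _ (binomial_tail p01' (spokes u Z) (p * #|Z|%:R / 2) l01)) _.
  apply: le_Pr => // S; rewrite /typical_u -leNgt card_spokesI // card_spokes //.
  rewrite /A /non_nbrs Nv -/(non_nbrs G) -/Z nbrs_mixI_in // => w e wZ eE.
  by apply: mem_spokes eE _; apply: (fintype.subsetP Zo).
rewrite ler_wpM2l // ler_expR card_spokes //.
have := card_non_nbrs_ge tv; rewrite -/Z => Zn.
have /andP[p0 ph] := p01; have := mean_deg => md.
have : p * (n%:R / 4) <= p * #|Z|%:R by rewrite ler_wpM2l // ltW.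
rewrite expr2; lra.
Qed.

(** * Degrees of the vertices of A outside W *)

Definition near_set G : {set 'I_n} := others :\: W G.
Local Notation Q := near_set.

Lemma isolated_sub_others G : W G \subset others.
Proof. by apply: (fintype.subset_trans (finset.subsetDl _ _)); exact: finset.subsetDl. Qed.

Lemma private_sub_near G : A G \subset Q G.
Proof.
apply/fintype.subsetP => a; rewrite inE => /andP[au aZ]; rewrite inE.
have ao : a \in others by move: aZ; rewrite inE => /andP[].
by rewrite ao andbT /isolated_from_pair inE au.
Qed.

Lemma private_nbrs_notin_isolated G a : a \in A G -> a \notin W G.
Proof. by move=> /(fintype.subsetP (private_sub_near G)); rewrite inE => /andP[]. Qed.

Lemma card_near_isolated G : #|Q G|%:R + #|W G|%:R = n%:R - 2 :> R.
Proof.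
rewrite -card_others -natrD -(cardsID (W G) others) addnC.
by congr (_ + _)%:R; rewrite (finset.setIidPr (isolated_sub_others G)).
Qed.

(** Redrawing these edges preserves the neighbourhoods of [u] and [v], hence A, W and Q. *)
Definition off_pair : {set vpair n} :=
  [set e : vpair n | [disjoint (val e : {set 'I_n}) & [set u; v]]].

(** For [a] in A, the part of the degree that stays frozen when the edges between A and W are
    redrawn. *)
Definition outer_deg G a : nat := #|nbrs G a :\: W G|.

Lemma off_pair_mix G S w : w \in [set u; v] -> nbrs (mix off_pair G S) w = nbrs G w.
Proof.
move=> wuv; apply: nbrs_mix => b e eE; rewrite inE disjoint_sym.
by apply/negP => /disjointFr/(_ wuv); rewrite eE !inE eqxx.
Qed.

Lemma same_pair_nbrs G G' : nbrs G' u = nbrs G u -> nbrs G' v = nbrs G v ->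
  [/\ non_nbrs G' = non_nbrs G, A G' = A G, W G' = W G & Q G' = Q G].
Proof.
by move=> hu hv; split; rewrite /near_set /private_nbrs /isolated_from_pair /non_nbrs ?hu hv.
Qed.

Lemma private_adj_pair G a w : a \in A G -> w \in [set u; v] ->
  (w \in nbrs G a) = (w == u).
Proof.
rewrite !inE => /andP[au /andP[av _]] /orP[/eqP ->|/eqP ->].
  by rewrite adj_sym au eqxx.
by rewrite adj_sym (negbTE av) eq_sym (negbTE uv).
Qed.

(** The extra 1 is the edge to [u]; [v] is not adjacent to [a]. *)
Lemma outer_deg_near G a : a \in A G -> outer_deg G a = (#|nbrs G a :&: Q G|).+1.
Proof.
move=> aA; rewrite /outer_deg.
have -> : nbrs G a :\: W G = u |: (nbrs G a :&: Q G).
  apply/setP => w; rewrite [LHS]inE [RHS]inE finset.in_set1.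
  case: (boolP (w \in [set u; v])) => wuv.
    rewrite (private_adj_pair aA wuv) finset.in_setI (private_adj_pair aA wuv).
    have wW : w \notin W G.
      by apply: contraL wuv => /(fintype.subsetP (isolated_sub_others G)); rewrite inE.
    by rewrite wW; case: (w == u).
  have wu : w != u by apply: contraNneq wuv => ->; rewrite !inE eqxx.
  have wo : w \in others by rewrite inE.
  have QW : (w \in Q G) = (w \notin W G).
    by rewrite [LHS]finset.in_setD wo andbT.
  by rewrite (negbTE wu) /= finset.in_setI QW andbC.
by rewrite cardsU1 !inE eqxx !andbF.
Qed.

Lemma nbrs_off_pair_mix G S a : a \in A G ->
  nbrs (mix off_pair G S) a :&: Q G = nbrs S a :&: Q G.
Proof.
move=> /(fintype.subsetP (private_sub_near G)) aQ; apply: nbrs_mixI_in => w e wQ eE.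
have Qo b : b \in Q G -> b \notin [set u; v] by rewrite inE => /andP[_]; rewrite inE.
rewrite inE disjoint_subset; apply/fintype.subsetP => b; rewrite eE.
by rewrite !(inE, finset.in_set2) => /orP[/eqP ->|/eqP ->]; have := Qo _ aQ; have := Qo _ wQ; rewrite !finset.in_set2.
Qed.

(** One is subtracted for the edge to [u], and one from the size of Q because [a] itself lies in Q.
    The constant 14 leaves room for the window length and rounding (15) and for the successor of a
    window value (16, as in [central]). *)
Definition typical_deg G a : bool :=
  `|(outer_deg G a)%:R - 1 - p * (#|Q G|%:R - 1)| < 14 * s ^+ 2.

Definition typical_private G : {set 'I_n} := [set a in A G | typical_deg G a].

(** A deviation of order [s ^+ 2] can be of the order of the standard deviation, so typicality is
    asked of half of A only. *)
Definition good_degs G : bool := #|A G|%:R <= 2 * #|typical_private G|%:R :> R.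

(* An edge inside T is counted at both of its ends, hence the weights up to 2. *)
Lemma deg_sum_tail (B T : {set 'I_n}) : T \subset B ->
  Pr (fun S : graph n => #|T|%:R * (14 * s ^+ 2) <=
      `|\sum_(a in T) (#|nbrs S a :&: B|%:R - p * (#|B|%:R - 1))|) <=
    2 * expR (- (12 * #|T|%:R)).
Proof.
move=> TB; pose wt (e : vpair n) : R := \sum_(a in T) (e \in spokes a (B :\ a))%:R.
have s2 : 0 < s ^+ 2 by have := s2_large; lra.
have aB a : a \notin B :\ a by rewrite !inE eqxx.
have wt_sum (S : graph n) : \sum_(e in S) wt e = \sum_(a in T) #|nbrs S a :&: B|%:R.
  rewrite exchange_big; apply: eq_bigr => a _ /=.
  rewrite -card_setI_sum card_spokesI //; congr (_%:R); apply: eq_card => w.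
  by rewrite !inE; case: eqP => [->|//]; rewrite adj_irrefl.
have wt_total : \sum_e wt e = #|T|%:R * (#|B|%:R - 1).
  rewrite exchange_big /= -sum1_card natr_sum mulr_suml; apply: eq_bigr => a aT.
  rewrite -card_sum card_spokes // mul1r (cardsD1 a B) (fintype.subsetP TB _ aT).
  by rewrite natrD addrC addKr.
have wt0 e : 0 <= wt e by apply: sumr_ge0 => a _; rewrite ler0n.
have wt2 e : wt e <= 2.
  apply: (@le_trans _ _ (\sum_(a in val e) 1)); last first.
    by rewrite sumr_const; have /eqP -> := valP e.
  rewrite /wt big_mkcond [leRHS]big_mkcond; apply: ler_sum => a _.
  case: (boolP (a \in val e)) => ae; first by case: ifP => //; rewrite lern1 leq_b1.
  case: ifP => // _; rewrite lern0 eqb0 inE; apply/existsP => -[w /andP[_ /eqP eE]].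
  by move: ae; rewrite eE !inE eqxx.
(* As weights are at most 2, the sum of squares is at most twice the total weight. *)
have wt_sq : \sum_e wt e ^+ 2 <= 2 * #|T|%:R * n%:R.
  apply: (@le_trans _ _ (\sum_e 2 * wt e)).
    by apply: ler_sum => e _; rewrite expr2 ler_wpM2r.
  rewrite -mulr_sumr wt_total -mulrA ler_wpM2l // ler_wpM2l //.
  have : #|B|%:R <= n%:R :> R by rewrite ler_nat -[leqRHS]card_ord max_card.
  by lra.
have l0 : 0 <= (s ^+ 2)^-1 by rewrite invr_ge0 ltW.
have lw e : `|(s ^+ 2)^-1 * wt e| <= 1 / 3.
  rewrite ger0_norm ?mulr_ge0 // mulrC ler_pdivrMr //.
  by have := wt2 e; have := s2_large; lra.
(* With rate [(s ^+ 2)^-1] the exponent is at most [2|T| - 14|T|]. *)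
apply: le_trans (le_trans _ (weighted_tail p01' (#|T|%:R * (14 * s ^+ 2)) l0 lw)) _.
  apply: le_Pr => // S; rewrite sumrB sumr_const -[(p * _) *+ _]mulr_natl -wt_sum.
  suff -> : p * \sum_e wt e = #|T|%:R * (p * (#|B|%:R - 1)) by [].
  by rewrite wt_total mulrCA.
rewrite ler_wpM2l // ler_expR.
have -> : (s ^+ 2)^-1 * (#|T|%:R * (14 * s ^+ 2)) = 14 * #|T|%:R.
  by field; apply: contraTneq s2 => ->; rewrite expr0n ltxx.
have h : p * (s ^+ 2)^-1 ^+ 2 * \sum_e wt e ^+ 2 <= p * (s ^+ 2)^-1 ^+ 2 * (2 * #|T|%:R * n%:R).
  have /andP[p0 _] := p01; rewrite ler_wpM2l // mulr_ge0 ?(ltW p0) //.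
  by rewrite exprn_ge0.
have : p * (s ^+ 2)^-1 ^+ 2 * (2 * #|T|%:R * n%:R) = 2 * #|T|%:R.
  transitivity (2 * #|T|%:R * (p * n%:R) * (s ^+ 2)^-1 ^+ 2); first by ring.
  rewrite mean_deg; field; apply: contraTneq s2 => ->; by rewrite expr0n ltxx.
by lra.
Qed.

(* If half of A is atypical, a quarter of A deviates in the same direction, and
   the union bound over the 2^|A| candidate sets is affordable. *)
Lemma good_degs_tail :
  Pr (fun G => good_sizes G && ~~ good_degs G) <= 2 * expR (- (s ^+ 4 / 8)).
Proof.
have inv G S : [/\ non_nbrs (mix off_pair G S) = non_nbrs G, A (mix off_pair G S) = A G,
    W (mix off_pair G S) = W G & Q (mix off_pair G S) = Q G].
  by apply: same_pair_nbrs; apply: off_pair_mix; rewrite !inE eqxx ?orbT.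
apply: (Pr_cond_le p01' (F := fun=> off_pair)) => //.
  by move=> G S; rewrite /good_sizes; have [_ -> -> _] := inv G S.
move=> G /and3P[A_ge _ _].
pose X (S : graph n) a : R := #|nbrs S a :&: Q G|%:R - p * (#|Q G|%:R - 1).
pose ev (T : {set 'I_n}) := fun S : graph n =>
  #|T|%:R * (14 * s ^+ 2) <= `|\sum_(a in T) X S a|.
pose big_sub (T : {set 'I_n}) := (T \subset A G) && (#|A G| <= 4 * #|T|)%N.
have bad S : ~~ good_degs (mix off_pair G S) -> [exists T, big_sub T && ev T S].
  rewrite /good_degs /typical_private; have [_ -> _ _] := inv G S.
  rewrite -ltNge => few.
  set A0 := [set a in A G | _] in few.
  have A0E a : a \in A0 = (a \in A G) && (`|X S a| < 14 * s ^+ 2).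
    rewrite inE; case: (boolP (a \in A G)) => [aA|_]; last by rewrite andFb.
    rewrite /typical_deg outer_deg_near; last by have [_ -> _ _] := inv G S.
    have [_ _ _ ->] := inv G S.
    by rewrite nbrs_off_pair_mix // -natr1 addrK.
  set Tp := [set a in A G | 14 * s ^+ 2 <= X S a].
  set Tm := [set a in A G | 14 * s ^+ 2 <= - X S a].
  have cover : (#|A G| <= #|A0| + (#|Tp| + #|Tm|))%N.
    apply: leq_trans (leq_add (leqnn _) (leq_card_setU Tp Tm)).
    apply: leq_trans (leq_card_setU A0 (Tp :|: Tm)); apply: subset_leq_card.
    apply/fintype.subsetP => a aA; rewrite !finset.in_setU A0E aA /=.
    have -> : (a \in Tp) = (14 * s ^+ 2 <= X S a) by rewrite inE aA.
    have -> : (a \in Tm) = (14 * s ^+ 2 <= - X S a) by rewrite inE aA.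
    by rewrite -ler_normr leNgt orbN.
  have few' : (2 * #|A0| < #|A G|)%N by rewrite -(ltr_nat R) natrM.
  have sub (B : pred 'I_n) : [set a in A G | B a] \subset A G.
    by apply/fintype.subsetP => a; rewrite inE => /andP[].
  have [hp|hm] : (#|A G| <= 4 * #|Tp|)%N \/ (#|A G| <= 4 * #|Tm|)%N.
    by clear -cover few'; lia.
    apply/existsP; exists Tp; rewrite /big_sub sub hp /= /ev ler_normr.
    apply/orP; left; rewrite [#|Tp|%:R * _]mulr_natl -sumr_const.
    by apply: ler_sum => a; rewrite inE => /andP[].
  apply/existsP; exists Tm; rewrite /big_sub sub hm /= /ev ler_normr.
  apply/orP; right; rewrite -sumrN [#|Tm|%:R * _]mulr_natl -sumr_const.
  by apply: ler_sum => a; rewrite inE => /andP[].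
apply: le_trans (le_Pr p01' bad) _.
apply: le_trans (Pr_exists_le p01' _ _) _.
(* A set [T] of at least [|A|/4] vertices has exponent [-12|T| <= -3|A|], against [2^|A| <= e^|A|]
   candidates. *)
apply: (@le_trans _ _ (\sum_(T in powerset (A G)) 2 * expR (- (3 * #|A G|%:R)))).
  rewrite [leLHS]big_mkcond [leRHS]big_mkcond; apply: ler_sum => T _.
  rewrite powersetE /big_sub; case: (boolP (T \subset A G)) => //= TA.
  case: ifP => [big|_]; last by rewrite mulr_ge0 ?expR_ge0.
  apply: le_trans (deg_sum_tail (fintype.subset_trans TA (private_sub_near G))) _.
  rewrite ler_wpM2l // ler_expR.
  have : #|A G|%:R <= (4 * #|T|)%:R :> R by rewrite ler_nat.
  by rewrite natrM; lra.
rewrite sumr_const card_powerset -[_ *+ (2 ^ _)%N]mulr_natl natrX mulrCA ler_wpM2l //.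
apply: (@le_trans _ _ (expR #|A G|%:R * expR (- (3 * #|A G|%:R)))).
  rewrite ler_wpM2r ?expR_ge0 // -[X in expR X]mulr1 expRM_natl.
  by apply: lerXn2r; rewrite ?nnegrE ?expR_ge0 //; have := expR_ge1Dx (1 : R); lra.
by rewrite -expRD ler_expR; have : 0 <= #|A G|%:R :> R := ler0n _ _; lra.
Qed.

(** * Redrawing the edges between A and W *)

(* Empty off A, so that the family is pairwise disjoint over all vertices. *)
Definition private_spokes G a : {set vpair n} :=
  if a \in A G then spokes a (W G) else finset.set0.

Definition cross_edges G : {set vpair n} := \bigcup_(a in A G) spokes a (W G).

Lemma cross_edgeP G (e : vpair n) : reflect
  (exists a w, [/\ a \in A G, w \in W G & val e = [set a; w]]) (e \in cross_edges G).
Proof.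
apply: (iffP bigcupP) => [[a aA]|[a [w [aA wW eE]]]]; last first.
  by exists a => //; apply: mem_spokes eE wW.
by rewrite inE => /existsP[w /andP[wW /eqP eE]]; exists a, w.
Qed.

Lemma private_spokes_disj G a a' : a != a' ->
  [disjoint private_spokes G a & private_spokes G a'].
Proof.
move=> aa'; rewrite -setI_eq0; apply/eqP/setP => e; rewrite finset.in_set0 finset.in_setI.
rewrite /private_spokes; case: (boolP (a \in A G)) => aA; last by rewrite finset.in_set0.
case: (boolP (a' \in A G)) => a'A; last by rewrite finset.in_set0 andbF.
apply/negbTE; rewrite negb_and -implybE; apply/implyP; rewrite !inE.
move=> /existsP[w /andP[wW /eqP eE]]; apply/existsP => -[w' /andP[w'W /eqP eE']].
have : a \in [set a'; w'] by rewrite -eE' eE !inE eqxx.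
rewrite finset.in_set2 (negbTE aa') /= => /eqP aw'.
by have := private_nbrs_notin_isolated aA; rewrite aw' w'W.
Qed.

Lemma not_cross_edge G w b (e : vpair n) : w \notin A G -> w \notin W G ->
  val e = [set w; b] -> e \notin cross_edges G.
Proof.
move=> wA wW eE; apply/cross_edgeP => -[a [c [aA cW eE']]].
have : w \in [set a; c] by rewrite -eE' eE !inE eqxx.
by rewrite finset.in_set2 => /orP[] /eqP wE; [rewrite wE aA in wA|rewrite wE cW in wW].
Qed.

Lemma deg_cross_mix_fixed G S w : w \notin A G -> w \notin W G ->
  nbrs (mix (cross_edges G) G S) w = nbrs G w.
Proof. by move=> wA wW; apply: nbrs_mix => b e; apply: not_cross_edge. Qed.

Lemma pair_notin_private G w : w \in [set u; v] -> w \notin A G.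
Proof. by move=> wuv; rewrite !inE -finset.in_set2 wuv /= !andbF. Qed.

Lemma pair_notin_isolated G w : w \in [set u; v] -> w \notin W G.
Proof.
by move=> wuv; apply/negP => /(fintype.subsetP (isolated_sub_others G)); rewrite inE wuv.
Qed.

Lemma u_in_pair : u \in [set u; v]. Proof. by rewrite finset.in_set2 eqxx. Qed.
Lemma v_in_pair : v \in [set u; v]. Proof. by rewrite finset.in_set2 eqxx orbT. Qed.

Lemma cross_mix_pair G S w : w \in [set u; v] ->
  nbrs (mix (cross_edges G) G S) w = nbrs G w.
Proof.
by move=> wuv; apply: deg_cross_mix_fixed; rewrite ?pair_notin_private ?pair_notin_isolated.
Qed.

Lemma cross_mix_sets G S (G' := mix (cross_edges G) G S) :
  [/\ non_nbrs G' = non_nbrs G, A G' = A G, W G' = W G & Q G' = Q G].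
Proof. by apply: same_pair_nbrs; apply: cross_mix_pair; rewrite (u_in_pair, v_in_pair). Qed.

(** No edge at [u] or [v] is redrawn, so A and W survive. This is the invariance that [Pr_cond_le]
    asks of a redrawn set depending on the graph. *)
Lemma cross_edges_mix G S : cross_edges (mix (cross_edges G) G S) = cross_edges G.
Proof. by rewrite {1}/cross_edges; have [_ -> -> _] := cross_mix_sets G S. Qed.

Lemma outer_deg_mix G S a : a \in A G ->
  outer_deg (mix (cross_edges G) G S) a = outer_deg G a.
Proof.
move=> aA; rewrite /outer_deg; have [_ _ -> _] := cross_mix_sets G S.
rewrite !finset.setDE (nbrs_mixI (F := cross_edges G)) // => w e; rewrite finset.in_setC => wW eE.
apply/cross_edgeP => -[b [c [bA cW eE']]].
have : c \in [set a; w] by rewrite -eE eE' !inE eqxx orbT.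
rewrite finset.in_set2 => /orP[] /eqP cE; last by rewrite -cE cW in wW.
by have := private_nbrs_notin_isolated aA; rewrite -cE cW.
Qed.

(** The degree is a frozen shift plus a fresh binomial; disjointness of the [private_spokes] makes
    these binomials independent. *)
Lemma deg_cross_mix G S a : a \in A G ->
  deg (mix (cross_edges G) G S) a = (outer_deg G a + #|S :&: private_spokes G a|)%N.
Proof.
move=> aA; rewrite /deg -(cardsID (W G)) addnC; congr addn.
  by rewrite -(outer_deg_mix S aA) /outer_deg; have [_ _ -> _] := cross_mix_sets G S.
rewrite /private_spokes aA card_spokesI ?private_nbrs_notin_isolated //.
rewrite nbrs_mixI_in // => w e wW eE.
by apply/cross_edgeP; exists a, w.
Qed.

Definition good_pair G : bool := good_sizes G && good_degs G.

Lemma good_pair_mix G S : good_pair (mix (cross_edges G) G S) = good_pair G.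
Proof.
rewrite /good_pair /good_sizes /good_degs.
have -> : typical_private (mix (cross_edges G) G S) = typical_private G.
  have [_ AE _ QE] := cross_mix_sets G S.
  apply/setP => a; rewrite [LHS]inE [RHS]inE.
  rewrite AE; case: (boolP (a \in A G)) => [aA|_]; last by rewrite !andFb.
  by rewrite !andTb /typical_deg QE (outer_deg_mix S aA).
by have [_ -> -> _] := cross_mix_sets G S.
Qed.

(** * The window of degrees and the discrepancy *)

Definition window_size : nat := (Num.truncn (s ^+ 2 / 2)).+1.

(** Counts down from the floor of [p n], so that every value passes the degree cutoff of
    [deg_nbhd]. *)
Definition window (j : 'I_window_size) : nat := (Num.truncn (s ^+ 4) - j)%N.

Lemma window_size_ge : s ^+ 2 / 2 <= window_size%:R.
Proof.
by apply/ltW; rewrite /window_size truncnS_gt.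
Qed.

Lemma window_bounds (j : 'I_window_size) :
  (j <= Num.truncn (s ^+ 4))%N /\
  s ^+ 4 - 1 - s ^+ 2 / 2 <= (window j)%:R <= s ^+ 4.
Proof.
have h0 : 0 <= s ^+ 2 / 2 by have := s2_large; lra.
have h4 : 0 <= s ^+ 4 by rewrite s4E; have := s2_large; nra.
have /andP[t1 t2] := truncn_itv h0; have /andP[t3 t4] := truncn_itv h4.
have jle : j%:R <= s ^+ 2 / 2.
  by apply: le_trans t1; rewrite ler_nat -ltnS ltn_ord.
have {}t4 : s ^+ 4 < (Num.truncn (s ^+ 4))%:R + 1 by rewrite natr1.
have jt : (j <= Num.truncn (s ^+ 4))%N.
  rewrite -(ler_nat R); move: t4; rewrite s4E; have := s2_large; nra.
split=> //; rewrite /window natrB //; apply/andP; split; first by lra.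
by have : 0 <= j%:R :> R := ler0n _ _; lra.
Qed.

Lemma window_inj : injective window.
Proof.
move=> i j; have [hi _] := window_bounds i; have [hj _] := window_bounds j.
rewrite /window => h; apply: val_inj => /=.
by rewrite -(subKn hi) h subKn.
Qed.

(* The constants b_x of the discrepancy: they do not change when the edges
   between A and W are resampled. *)
Definition fixed_count G (j : 'I_window_size) : R :=
  #|[set w in nbrs G v | deg G w == window j]|%:R -
  #|[set w in nbrs G u :\: A G | deg G w == window j]|%:R.

(** Neighbours of [v], and those of [u] outside A, belong to neither A nor W and keep their degrees.
    Only the vertices of A have new degrees, and they are counted for [u] alone. *)
Lemma discrepancy_le_msymdiff G S (G' := mix (cross_edges G) G S) :
  discrepancy (A G) (private_spokes G) (outer_deg G) window (fixed_count G) S <=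
  (msymdiff_size (deg_nbhd G' (p * n%:R) u) (deg_nbhd G' (p * n%:R) v))%:R.
Proof.
apply: le_trans (_ : _ <= (\sum_j `|(deg_nbhd G' (p * n%:R) u (window j))%:Z -
    (deg_nbhd G' (p * n%:R) v (window j))%:Z|%N)%:R) _; last first.
  by rewrite ler_nat; apply: msymdiff_size_ge window_inj.
rewrite natr_sum; apply: ler_sum => j _.
have win : (window j)%:R <= p * n%:R.
  by rewrite mean_deg; have [_ /andP[]] := window_bounds j.
have fixed_deg w : w \notin A G -> w \notin W G -> deg G' w = deg G w.
  by move=> wA wW; rewrite /deg deg_cross_mix_fixed.
have WuF w : w \in W G -> w \notin nbrs G u by rewrite finset.in_setD => /andP[].
have WvF w : w \in W G -> w \notin nbrs G v.
  by rewrite finset.in_setD => /andP[_]; rewrite finset.in_setD => /andP[].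
have AvF w : w \in A G -> w \notin nbrs G v.
  by rewrite finset.in_setI => /andP[_]; rewrite finset.in_setD => /andP[].
have AuT w : w \in A G -> w \in nbrs G u by rewrite finset.in_setI => /andP[].
rewrite !deg_nbhdE // !cross_mix_pair ?u_in_pair ?v_in_pair //.
have -> : [set w in nbrs G v | deg G' w == window j] =
    [set w in nbrs G v | deg G w == window j].
  apply/setP => w; rewrite [LHS]inE [RHS]inE; case: (boolP (w \in nbrs G v)) => // wv.
  by rewrite fixed_deg //; apply: contraL wv => h; [apply: AvF|apply: WvF].
set cu := #|_|; set cv := #|_|.
have <- : `|cu%:R - cv%:R : R| = `|cu%:Z - cv%:Z|%N%:R by rewrite natr_absz intr_norm rmorphB.
have -> : cu%:R = \sum_(a in A G) (hit (private_spokes G) (outer_deg G) window j a S)%:R +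
    #|[set w in nbrs G u :\: A G | deg G w == window j]|%:R :> R.
  have -> : cu = (#|[set w in A G | deg G' w == window j]| +
      #|[set w in nbrs G u :\: A G | deg G w == window j]|)%N.
    rewrite /cu -(cardsID (A G)); congr addn; apply: eq_card => w.
      rewrite finset.in_setI [LHS]andbC [in LHS]inE [RHS]inE.
      by case: (boolP (w \in A G)) => //= /AuT ->.
    rewrite finset.in_setD [in LHS]inE [RHS]inE finset.in_setD.
    case: (boolP (w \in A G)) => //= wA; case: (boolP (w \in nbrs G u)) => //= wu.
    by rewrite fixed_deg //; apply: contraL wu; apply: WuF.
  rewrite natrD; congr (_ + _); rewrite -sum1_card natr_sum.
  rewrite [RHS]big_mkcond [LHS]big_mkcond; apply: eq_bigr => a _.
  rewrite inE; case: (boolP (a \in A G)) => //= aA.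
  by rewrite /hit deg_cross_mix //; case: eqP.
by rewrite /fixed_count -/cv opprB addrA.
Qed.

(** Since Q and W together have [n - 2] vertices, the conditional mean degree of a typical vertex is
    within [14 * s ^+ 2] of [p n], up to a bounded error. The window, of length about [s ^+ 2 / 2],
    ends at [p n]. *)
Lemma good_pair_centred G a (j : 'I_window_size) : a \in typical_private G ->
  `|(window j)%:R - (outer_deg G a)%:R - p * #|W G|%:R| <= 15 * s ^+ 2.
Proof.
rewrite inE => /andP[_]; rewrite /typical_deg ltr_norml => /andP[d1 d2].
have [_ /andP[w1 w2]] := window_bounds j.
have /andP[p0 ph] := p01; have := s2_large.
have QW := card_near_isolated G.
have e : p * #|W G|%:R = s ^+ 4 - 3 * p - p * (#|Q G|%:R - 1).
  rewrite -mean_deg; have -> : #|W G|%:R = n%:R - 2 - #|Q G|%:R :> R by rewrite -QW; ring.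
  by ring.
by rewrite ler_norml e => ?; apply/andP; split; lra.
Qed.

(** * Failure probability of one pair *)

Lemma cross_tail (k : R) : k <= disc_const R * s ^+ 3 ->
  Pr (fun G => good_pair G && ~~ disjoint_deg_nbhds G (p * n%:R) k u v) <=
    expR (- (disc_const R ^+ 2 / 32 * s ^+ 2)).
Proof.
move=> k_le; apply: (Pr_cond_le p01' (F := cross_edges)).
- exact: expR_ge0.
- exact: cross_edges_mix.
- exact: good_pair_mix.
move=> G /andP[/and3P[A_ge A_le W_ge] degs].
have s4 : 0 <= s ^+ 4 by rewrite s4E; have := s2_large; nra.
apply: le_trans (le_trans _ (@discrepancy_tail _ _ p p01 _ (A G) (private_spokes G) #|W G|
  (outer_deg G) _ window (fixed_count G) s _ _ _ _ _ _ _ (typical_private G) _ _ _)) _ => //.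
- apply: le_Pr => // S; rewrite /disjoint_deg_nbhds -ltNge => lt_k.
  by apply: le_trans (discrepancy_le_msymdiff G S) _; apply: ltW; apply: lt_le_trans k_le.
- exact: private_spokes_disj.
- by move=> a aA; rewrite /private_spokes aA card_spokes ?private_nbrs_notin_isolated.
- exact: window_inj.
- have /andP[p0 ph] := p01; rewrite -mean_deg -mulrA !ler_pM2l // W_ge ler_nat.
  by rewrite -[leqRHS](card_ord n) max_card.
- exact: window_size_ge.
- by apply/fintype.subsetP => a; rewrite inE => /andP[].
- by move: degs; rewrite /good_degs; lra.
- by move=> a j; apply: good_pair_centred.
Qed.

(** The constant 7 is 4 for bad sizes, 2 for bad degrees and 1 for a small discrepancy; each
    exponential is at most [x]. *)
Lemma pair_failure_tail (k : R) : k <= disc_const R * s ^+ 3 ->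
  Pr (fun G => ~~ disjoint_deg_nbhds G (p * n%:R) k u v) <=
    7 * expR (- (disc_const R ^+ 2 / 32 * s ^+ 2)).
Proof.
move=> k_le; set x := expR _.
have z0 := disc_const_gt0 R; have z1 := disc_const_le1 R.
have z2 : disc_const R ^+ 2 / 32 <= 1 / 32 by nra.
have small y : s ^+ 2 / 32 <= y -> expR (- y) <= x.
  by move=> hy; rewrite /x ler_expR lerN2; apply: le_trans hy; have := s2_large; nra.
have s4 := s4E; have s2 := s2_large; have nl := n_large.
have h1 : expR (- (n%:R / 128)) <= x by apply: small; nra.
have h2 : expR (- (s ^+ 4 / 64)) <= x by apply: small; nra.
have h3 : expR (- (s ^+ 4 / 8)) <= x by apply: small; nra.
have := good_sizes_tail; have := good_degs_tail; have := cross_tail k_le; rewrite -/x => c1 c2 c3.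
apply: (@le_trans _ _ (Pr (fun G => ~~ good_sizes G) +
  (Pr (fun G => good_sizes G && ~~ good_degs G) +
   Pr (fun G => good_pair G && ~~ disjoint_deg_nbhds G (p * n%:R) k u v)))); last by lra.
apply: le_trans (lerD (lexx _) (PrU_le p01' _ _)).
apply: le_trans (PrU_le p01' _ _); apply: le_Pr => // G.
rewrite /good_pair; case: (good_sizes G) => //=; case: (good_degs G) => //=.
Qed.

End VertexPair.

(** * Union bound and asymptotics *)

Lemma Pr_GnpE (R : realType) (n : nat) (p : R) (A : pred (graph n)) :
  Pr_Gnp p A = Pr p A.
Proof.
rewrite /Pr_Gnp big_mkcond; apply: eq_bigr => G _.
by case: (A G); rewrite ?mulr1 ?mulr0.
Qed.

Lemma all_pairs_tail (R : realType) (n : nat) (p s k : R) :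
  0 < p <= 1 / 2 -> p * n%:R = s ^+ 4 -> 50 <= s -> k <= disc_const R * s ^+ 3 ->
  1 - n%:R ^+ 2 * (7 * expR (- (disc_const R ^+ 2 / 32 * s ^+ 2))) <=
  Pr_Gnp p (fun G : graph n => [forall u : 'I_n, forall v : 'I_n,
    (u != v) ==> disjoint_deg_nbhds G (p * n%:R) k u v]).
Proof.
move=> p01 md s50 kle; have p01' : 0 <= p <= 1.
  by case/andP: p01 => ? ?; apply/andP; split; lra.
set good := fun G : graph n => _; rewrite Pr_GnpE.
have := PrC p good; suff : Pr p (fun G => ~~ good G) <=
  n%:R ^+ 2 * (7 * expR (- (disc_const R ^+ 2 / 32 * s ^+ 2))) by lra.
pose bad (uv : 'I_n * 'I_n) := fun G : graph n =>
  ~~ disjoint_deg_nbhds G (p * n%:R) k uv.1 uv.2.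
apply: (@le_trans _ _ (Pr p (fun G => [exists uv, (uv.1 != uv.2) && bad uv G]))).
  apply: le_Pr => // G; rewrite /good negb_forall => /existsP[u].
  rewrite negb_forall => /existsP[v]; rewrite negb_imply => uv.
  by apply/existsP; exists (u, v).
apply: le_trans (Pr_exists_le p01' _ _) _.
set t := 7 * _; have t0 : 0 <= t by rewrite mulr_ge0 ?expR_ge0.
apply: (@le_trans _ _ (\sum_(uv : 'I_n * 'I_n) t)); last first.
  by rewrite sumr_const card_prod card_ord -[t *+ _]mulr_natl natrM expr2.
rewrite big_mkcond; apply: ler_sum => -[u v] _ /=; case: ifP => // uv.
exact: pair_failure_tail.
Qed.

Local Open Scope classical_set_scope.

Lemma near_le_ln (R : realType) (B : R) : \forall n \near \oo, B <= ln (n%:R : R).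
Proof.
near=> n; have h : expR B <= n%:R by near: n; exact: nbhs_infty_ger.
by rewrite -[B]expRK ler_ln ?posrE ?expR_gt0 // (lt_le_trans (expR_gt0 B)).
Unshelve. all: by end_near. Qed.

(** Converts the growth condition on [d] to the scale [s ^+ 3]: for [p n = s ^+ 4] the power 3/4
    gives [s ^+ 3], and dividing by quantities that are at least 1 only decreases it. *)
Lemma powR_scale_le (R : realType) (s l m : R) : 0 <= s -> 1 <= l -> 1 <= m ->
  (s ^+ 4 / l) `^ (3 / 4) / m `^ (1 / 4) <= s ^+ 3.
Proof.
move=> s0 l1 m1; have l0 : 0 < l by lra.
have hm : 1 <= m `^ (1 / 4).
  have e1 : 1 `^ (1 / 4) = 1 :> R by rewrite powR1.
  by rewrite -[leLHS]e1; apply: ge0_ler_powR; rewrite ?nnegrE //; lra.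
have -> : s ^+ 3 = (s ^+ 4) `^ (3 / 4).
  rewrite -(powR_mulrn 4 s0) -powRrM -(powR_mulrn 3 s0); congr (_ `^ _); by field.
rewrite ler_pdivrMr; last by lra.
apply: (@le_trans _ _ ((s ^+ 4) `^ (3 / 4))); last by rewrite ler_peMr ?powR_ge0.
have s4 : 0 <= s ^+ 4 by rewrite exprn_ge0.
apply: ge0_ler_powR; rewrite ?nnegrE ?divr_ge0 ?(ltW l0) //.
by rewrite ler_pdivrMr // ler_peMr.
Qed.

Theorem theorem22 (R : realType) (p d : nat -> R)
  (p_lower : little_omega p
     (fun n => (ln n%:R) ^+ 4 * ln (ln n%:R) / n%:R))
  (p_upper : \forall n \near \oo, p n <= 1 / 2)
  (d_small : d =o_\oo (fun n =>
     (p n * n%:R / ln n%:R) `^ (3 / 4) / (ln (p n * n%:R)) `^ (1 / 4))) :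
  exists2 g : nat -> R, little_omega g (fun n => ln n%:R) &
    \forall n \near \oo,
      1 - expR (- g n) <=
        Pr_Gnp (p n) (fun G : graph n =>
          [forall u : 'I_n, forall v : 'I_n, (u != v) ==>
             disjoint_deg_nbhds G (p n * n%:R) (4 * d n + 1) u v]).
Proof.
set dc := disc_const R; have dc0 : 0 < dc := disc_const_gt0 R.
pose c : R := dc ^+ 2 / 32; have c0 : 0 < c by rewrite divr_gt0 ?exprn_gt0.
(* The tail has exponent [c * s ^+ 2 >= c * (ln n) ^+ 2]; half of it is given up to absorb the
   factor [7 * n ^+ 2]. *)
exists (fun n => c / 2 * (ln n%:R) ^+ 2).
  apply/cvgryPge => B; near=> n.
  have L1 : 1 <= ln n%:R :> R by near: n; exact: near_le_ln.
  have LB : B / (c / 2) <= ln n%:R by near: n; exact: near_le_ln.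
  have -> : c / 2 * (ln n%:R) ^+ 2 / ln n%:R = ln n%:R * (c / 2) :> R.
    by field; apply: lt0r_neq0; lra.
  by rewrite -ler_pdivrMr // divr_gt0.
(* With [dc / 8], the term [4 * d n] takes half of [dc * s ^+ 3], and the other half covers the
   summand 1. *)
have dsmall := (eqoP _ _ _).1 d_small (dc / 8) (divr_gt0 dc0 (ltr0n _ 8)).
near=> n.
have L50 : 50 <= ln n%:R :> R by near: n; exact: near_le_ln.
have Le : expR 1 <= ln n%:R :> R by near: n; exact: near_le_ln.
have Ldc : 2 / dc <= ln n%:R :> R by near: n; exact: near_le_ln.
have Lc : 6 / c <= ln n%:R :> R by near: n; exact: near_le_ln.
have p2 : p n <= 1 / 2 by near: n.
have dn : `|d n| <= dc / 8 * `|(p n * n%:R / ln n%:R) `^ (3 / 4) /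
    (ln (p n * n%:R)) `^ (1 / 4)| by near: n.
have pn : 1 <= p n / ((ln n%:R) ^+ 4 * ln (ln n%:R) / n%:R).
  by near: n; exact: (cvgryPge _).1 p_lower 1.
(* [ln] takes the value 0 at 0, so a large logarithm excludes [n = 0]. *)
have n1 : (0 < n)%N.
  by rewrite lt0n; apply: contraTneq L50 => ->; rewrite ln0 // -ltNge.
have n0 : 0 < n%:R :> R by rewrite ltr0n.
set L := ln n%:R in L50 Le Ldc Lc dn pn *.
have L0 : 0 < L by lra.
have lnL : 1 <= ln L by rewrite -[1 in leLHS]expRK ler_ln ?posrE ?expR_gt0.
have L4 : 0 < L ^+ 4 by rewrite exprn_gt0.
have low0 : 0 < L ^+ 4 * ln L / n%:R by rewrite divr_gt0 // mulr_gt0 //; lra.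
have N_ge : L ^+ 4 <= p n * n%:R.
  move: pn; rewrite ler_pdivlMr // mul1r ler_pdivrMr //.
  by apply: le_trans; rewrite ler_peMr // ltW.
have p0 : 0 < p n by rewrite -(pmulr_lgt0 _ n0); apply: lt_le_trans N_ge.
set N := p n * n%:R in N_ge dn *.
have N0 : 0 <= N by lra.
pose s := Num.sqrt (Num.sqrt N).
have s0 : 0 <= s := sqrtr_ge0 _.
have s4 : N = s ^+ 4 by rewrite -[4%N]/(2 * 2)%N exprM !sqr_sqrtr ?sqrtr_ge0.
(* Fourth root of [L ^+ 4 <= p n], which follows from [p_lower] once [ln L >= 1]. *)
have sL : L <= s.
  by rewrite -(@ler_pXn2r _ 4) ?nnegrE ?(ltW L0) // -s4.
have N_L : L <= N.
  have L1 : 1 <= L by lra.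
  by apply: le_trans N_ge; rewrite exprS ler_peMr ?(ltW L0) // exprn_ege1.
have lnN : 1 <= ln N.
  by rewrite -[1 in leLHS]expRK ler_ln ?posrE ?expR_gt0 //; lra.
have k_le : 4 * d n + 1 <= dc * s ^+ 3.
  have h := @powR_scale_le R s L (ln N) s0 _ lnN; rewrite -s4 in h.
  have {}h : (N / L) `^ (3 / 4) / (ln N) `^ (1 / 4) <= s ^+ 3 by apply: h; lra.
  have e0 : 0 <= (N / L) `^ (3 / 4) / (ln N) `^ (1 / 4) by rewrite divr_ge0 ?powR_ge0.
  rewrite (ger0_norm e0) in dn; have := ler_norm (d n).
  have s1 : 1 <= s by lra.
  have s3 : s <= s ^+ 3 by rewrite [leRHS]exprS ler_peMr // exprn_ege1.
  have : 2 <= dc * L by rewrite mulrC -ler_pdivrMr.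
  have : dc / 8 * ((N / L) `^ (3 / 4) / (ln N) `^ (1 / 4)) <= dc / 8 * s ^+ 3.
    by rewrite ler_wpM2l // divr_ge0 // ltW.
  have : dc * L <= dc * s ^+ 3 by rewrite ler_wpM2l ?(ltW dc0) //; lra.
  by lra.
apply: le_trans (@all_pairs_tail R n (p n) s _ _ s4 _ k_le).
- rewrite lerD2l lerN2.
  have -> : n%:R = expR L :> R by rewrite lnK ?posrE.
  have h7 : 7 <= expR 6 :> R by have := expR_ge1Dx (6 : R); lra.
  apply: (@le_trans _ _ (expR L ^+ 2 * (expR 6 * expR (- (c * L ^+ 2))))).
    rewrite ler_wpM2l ?exprn_ge0 ?expR_ge0 //; apply: ler_pM; rewrite ?expR_ge0 //.
    rewrite ler_expR lerN2 ler_wpM2l ?(ltW c0) //.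
    by apply: lerXn2r; rewrite ?nnegrE ?(ltW L0).
  (* From [c * L >= 6] and [L >= 50], [c * L ^+ 2 / 2 >= 3 * L >= 2 * L + 6], which absorbs [n ^+ 2]
     and [7 <= expR 6]. *)
  rewrite -expRM_natr -!expRD ler_expR.
  have : 6 <= c * L by rewrite mulrC -ler_pdivrMr.
  by rewrite expr2; nra.
- by rewrite p0.
- by lra.
Unshelve. all: by end_near. Qed.
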